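(* For every real $\lambda>0$, let $(M(\lambda),o)$ be the unique (in distribution) random rooted connected multigraph with finite expected root degree that is invariant under the cluster process with parameter $\lambda$. Then the expected number of vertices of $M(\lambda)$ is finite: $\mathbb{E}(|M(\lambda)|)<\infty$.
   Context: A multigraph is a graph in which two vertices may be joined by several parallel edges; multigraphs here have no loops, and are not assumed finite. $|G|$ denotes the number of vertices of $G$. Rooted multigraphs are considered up to root-preserving isomorphism when comparing distributions. Full process. Let $\lambda>0$ and let $(G,o)$ be a (possibly random) rooted connected multigraph. The full process $(\overline{G}_t,o_t)_{t\ge 0}$ with parameter $\lambda$ is defined as follows. Set $(\overline{G}_0,o_0)=(G,o)$. Give each vertex $v$ a splitting time $\tau_v$, where the splitting times are i.i.d. $\operatorname{Exp}(1)$ variables (exponential of rate $1$). When $t=\tau_v$, replace $v$ with two new vertices $v_1,v_2$, and give each a splitting time of $t$ plus an independent $\operatorname{Exp}(1)$ variable. Add $\operatorname{Po}(\lambda/2)$ (a Poisson random number with mean $\lambda/2$) edges between $v_1$ and $v_2$. Moreover, replace each edge of the form $uv$ with one of the edges $uv_1,uv_2$ chosen uniformly at random. If $v$ was the root, update the root to be $v_1$ or $v_2$, each with probability $1/2$. All these random choices are made independently of each other (and of $(G,o)$). The resulting rooted multigraph at time $t$ is $(\overline{G}_t,o_t)$. Cluster process. The cluster process $(G_t,o_t)_{t\ge 0}$ with parameter $\lambda$ started from $(G,o)$ is the rooted connected multigraph formed by the connected component of the root $o_t$ in $\overline{G}_t$. Invariance. $(M,o)$ is invariant under the cluster process with parameter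 $\lambda$ if, running the cluster process from $(M_0,o_0)=(M,o)$, $(M_t,o_t)$ has the same distribution for every $t\ge 0$. It is known that for each $\lambda>0$ there is exactly one (in distribution) invariant random rooted connected multigraph whose root degree (counting parallel edges) has finite expectation; it is denoted $(M(\lambda),o)$. *)

(* Defs.v *)
From HB Require Import structures.
From Stdlib Require Import Relation_Operators.
From mathcomp Require Import all_boot all_order all_algebra.
From mathcomp Require Import all_classical all_reals all_analysis.

Set Implicit Arguments.
Unset Strict Implicit.
Unset Printing Implicit Defensive.

Import Order.TTheory GRing.Theory Num.Theory.

Local Open Scope classical_set_scope.
Local Open Scope ring_scope.

(* Raw data of a rooted multigraph: [vset] and [eset] are the labels actually
   in use, and [ends G e] is the set of endvertices of [e], meaningful only for
   [e] in [eset G].  The axioms are stated separately, in [multigraph]. *)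
Record rgraph (V E : Type) := RGraph {
  vset : set V;
  eset : set E;
  ends : E -> set V;
  groot : V
}.

Section RootedMultigraphs.
Variables V E : Type.
Implicit Type G : rgraph V E.

(* Edges join exactly two distinct vertices, so there are no loops; distinct
   edges may have the same ends, and degrees may be infinite. *)
Definition multigraph G : Prop :=
  vset G (groot G) /\
  forall e, eset G e ->
    exists u v, [/\ vset G u, vset G v, u <> v & ends G e = [set u; v]].

Definition linked G (u v : V) : Prop :=
  exists2 e, eset G e & ends G e u /\ ends G e v.

Definition reachable G : V -> V -> Prop := clos_refl_trans V (linked G).

Definition connected_multigraph G : Prop :=
  multigraph G /\ forall v, vset G v -> reachable G (groot G) v.

Definition root_component G : rgraph V E := {|
  vset := [set v | vset G v /\ reachable G (groot G) v];
  eset := [set e | eset G e /\ exists2 v, ends G e v & reachable G (groot G) v];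
  ends := ends G;
  groot := groot G
|}.

End RootedMultigraphs.

Definition rgraph_iso (V E V' E' : Type)
    (G : rgraph V E) (H : rgraph V' E') : Prop :=
  exists (f : V -> V') (g : E -> E'),
    [/\ set_bij (vset G) (vset H) f,
        set_bij (eset G) (eset H) g,
        forall e, eset G e -> ends H (g e) = f @` ends G e &
        f (groot G) = groot H].

Definition relabel (V E : countType) (G : rgraph V E) : rgraph nat nat := {|
  vset := pickle @` vset G;
  eset := pickle @` eset G;
  ends := fun n => [set m | exists e v,
            [/\ ends G e v, n = pickle e & m = pickle v]];
  groot := pickle (groot G)
|}.

Definition num_vertices {R : realType} (V E : choiceType) (G : rgraph V E) : \bar R :=
  counting (vset G).

Definition root_degree {R : realType} (V E : choiceType) (G : rgraph V E) :
    \bar R :=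
  counting [set e | eset G e /\ ends G e (groot G)].

(* The measurable space of rooted graphs labelled by natural numbers; every
   countable rooted multigraph has an isomorphic copy there. *)
Definition ngraph := rgraph nat nat.

HB.instance Definition _ := gen_eqMixin ngraph.
HB.instance Definition _ := gen_choiceMixin ngraph.
HB.instance Definition _ :=
  isPointed.Build ngraph (RGraph set0 set0 (fun=> set0) 0%N).

Definition ngraph_cylinders : set (set ngraph) :=
  [set A | [\/ exists v, A = [set G | vset G v],
               exists e, A = [set G | eset G e],
               exists e v, A = [set G | ends G e v] |
               exists v, A = [set G | groot G = v]]].

Definition ngraph_space := g_sigma_algebraType ngraph_cylinders.

Definition iso_invariant (A : set ngraph_space) : Prop :=
  forall G H : ngraph, rgraph_iso G H -> A G -> A H.

(* [(v, w)] is the descendant, along the binary word [w] (oldest split first),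
   of the initial vertex [v]. *)
Definition vertex : Type := (nat * seq bool)%type.

(* [inl e] is the initial edge [e]; [inr (x, k)] is the [k]-th edge added
   between the two offspring of [x]. *)
Definition edge : Type := (nat + vertex * nat)%type.

Definition initial (v : nat) : vertex := (v, [::]).
Definition child (x : vertex) (b : bool) : vertex := (x.1, rcons x.2 b).
Definition ancestor (x : vertex) (k : nat) : vertex := (x.1, take k x.2).

(* One realisation of all the random choices.  [lifetime x] is the time
   between the birth of [x] and its splitting, [new_edges x] the number of
   edges added when [x] splits, [root_choice x] the offspring of [x] becoming
   the root if [x] is the root when it splits, and [edge_choice e x] the
   offspring of [x] inheriting the edge [e] if [e] is at [x] when it splits. *)
Record noise (R : realType) := Noise {
  lifetime : vertex -> R;
  new_edges : vertex -> nat;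
  root_choice : vertex -> bool;
  edge_choice : edge -> vertex -> bool
}.

Section Process.
Variables (R : realType) (W : noise R) (G : ngraph) (t : R).

Definition split_time (x : vertex) : R :=
  \sum_(k < (size x.2).+1) lifetime W (ancestor x k).

Definition has_split (x : vertex) : Prop :=
  forall k, (k <= size x.2)%N -> split_time (ancestor x k) <= t.

Definition alive (x : vertex) : Prop :=
  (forall k, (k < size x.2)%N -> split_time (ancestor x k) <= t) /\
  t < split_time x.

(* The position at time [t] of a marker put on [x] at its birth and moving to
   [child y (choice y)] whenever the vertex [y] carrying it splits: at most one
   vertex, and almost surely exactly one if [x] is born by time [t]. *)
Definition position (choice : vertex -> bool) (x : vertex) : set vertex :=
  [set y | alive y /\ exists n, y = iter n (fun z => child z (choice z)) x].

Definition full_process : rgraph vertex edge := {|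
  vset := [set x | vset G x.1 /\ alive x];
  eset := [set e | match e with
            | inl e0 => eset G e0
            | inr (x, k) => [/\ vset G x.1, has_split x & (k < new_edges W x)%N]
            end];
  ends := fun e => match e with
            | inl e0 =>
                \bigcup_(v in ends G e0) position (edge_choice W e) (initial v)
            | inr (x, _) =>
                \bigcup_(b in [set: bool]) position (edge_choice W e) (child x b)
            end;
  groot := xget (initial (groot G))
                (position (root_choice W) (initial (groot G)))
|}.

Definition cluster_process : rgraph vertex edge := root_component full_process.

End Process.

Definition mutually_independent d (T : measurableType d) (R : realType)
    (P : probability T R) (I : Type) (F : I -> set (set T)) : Prop :=
  forall (n : nat) (i : 'I_n -> I), injective i ->
  forall A : 'I_n -> set T, (forall k, F (i k) (A k)) ->
    P (\bigcap_(k in [set: 'I_n]) A k) = (\prod_(k < n) P (A k))%E.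

Inductive source : Type :=
  | InitialGraph
  | Lifetime of vertex
  | NewEdges of vertex
  | RootChoice of vertex
  | EdgeChoice of edge & vertex.

Section RandomProcess.
Context d (T : measurableType d) (R : realType) (P : probability T R).
Variables (M : T -> ngraph_space) (W : T -> noise R).

Definition source_events (s : source) : set (set T) :=
  match s with
  | InitialGraph => preimage_set_system setT M measurable
  | Lifetime x =>
      preimage_set_system setT (fun w => lifetime (W w) x) measurable
  | NewEdges x =>
      preimage_set_system setT (fun w => new_edges (W w) x) measurable
  | RootChoice x =>
      preimage_set_system setT (fun w => root_choice (W w) x) measurable
  | EdgeChoice e x =>
      preimage_set_system setT (fun w => edge_choice (W w) e x) measurable
  end.

Record cluster_noise (lambda : R) : Prop := ClusterNoise {
  source_measurable : forall s, source_events s `<=` measurable;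
  lifetime_law : forall x (A : set R), measurable A ->
    P [set w | A (lifetime (W w) x)] = exponential_prob 1 A;
  new_edges_law : forall x k,
    P [set w | new_edges (W w) x = k] = (poisson_pmf (lambda / 2) k)%:E;
  root_choice_law : forall x b,
    P [set w | root_choice (W w) x = b] = (2^-1)%:E;
  edge_choice_law : forall e x b,
    P [set w | edge_choice (W w) e x = b] = (2^-1)%:E;
  source_independent : mutually_independent P source_events
}.

(* The law of a random rooted multigraph up to root-preserving isomorphism is
   its law on the isomorphism-invariant measurable sets. *)
Definition same_iso_law (X Y : T -> ngraph_space) : Prop :=
  forall A : set ngraph_space, measurable A -> iso_invariant A ->
    P (X @^-1` A) = P (Y @^-1` A).

Definition cluster_at (t : R) (w : T) : ngraph_space :=
  relabel (cluster_process (W w) (M w) t).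

Definition cluster_invariant : Prop :=
  forall t : R, 0 <= t -> same_iso_law (cluster_at t) M.

End RandomProcess.

(* Main.v *)
From HB Require Import structures.
From Stdlib Require Import Relation_Operators Operators_Properties.
Require Import Defs.
From mathcomp Require Import all_boot all_order all_algebra.
From mathcomp Require Import all_classical all_reals all_analysis measurable_realfun.
From mathcomp Require Import ring lra.

Set Implicit Arguments.
Unset Strict Implicit.
Unset Printing Implicit Defensive.

Import Order.TTheory GRing.Theory Num.Theory.
Import numFieldNormedType.Exports.

Local Open Scope classical_set_scope.
Local Open Scope ring_scope.

(* Idea of the proof. Let the block of a vertex be the set of its descendants.
   (1) The number of edges leaving the block of an ancestor of a given marker is
   a Markov chain D -> Bin(D, 1/2) + Po(lambda / 2) along the splits of the
   marker, and once it is 0 the marker is separated from everything outside the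
   current block. This chain admits a geometric Lyapunov function, so inside a
   block of age u two independent markers are connected with probability p(u)
   at most C exp(- c u).
   (2) Splitting a block into two blocks joined by Po(lambda / 2) edges, a vertex
   connected to a marker is either connected to it inside one half, or inside
   its half to a new edge whose other end is connected, in the other half, to
   the marker or to another new edge. Hence the expected size chi(u) of the
   cluster of a marker in a block of age u satisfies chi' <= C p chi, and is
   bounded because p is integrable.
   (3) At time t each edge of M at the root touches the cluster of the root
   inside its block with probability at most p(t), so that off an event of
   probability at most E[deg] p(t) the cluster at time t lies in one block. By
   invariance E[min(|M|, n)] <= sup chi + n E[deg] p(t), and t is arbitrary. *)

(** * Independence and freezing *)

(** The inequalities in the age [u] are used in integrated form. Conditioning a block on its first
    split gives a renewal inequality with kernel Exp(1), whose equality case is solved exactly by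
    exp (- c u), respectively by an exponential of a multiple of 1 - exp (- c u). An induction on
    the number of generations compares the probabilities with these solutions, which replaces any a
    priori finiteness or smoothness in [u]. The events that are bounded are not connections but
    recursive necessary conditions for them, each read from the noise of a single subtree. Disjoint
    subtrees then give independent events, which is where the product in (2) comes from. A path may
    cross between the two halves of a block many times. Only its first exit and the first return
    through another edge are recorded; this costs a factor quadratic in the number of new edges,
    hence the second Poisson moment. The truncation in (3) is what allows t to be chosen after n. *)

Section IndependentSigmaAlgebras.
Context d (T : measurableType d) (R : realType) (P : probability T R).
Variables (I : choiceType) (F : I -> set (set T)).
Hypothesis FT : forall i, F i setT.
Hypothesis FI : forall i, setI_closed (F i).
Hypothesis Fmeas : forall i, F i `<=` measurable.
Hypothesis Find : mutually_independent P F.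

(** A pi-system generating the sigma-algebra of the indices in [S]. Independence is checked here
    first, on finite products. *)
Definition finite_meets (S : set I) : set (set T) :=
  [set A | exists (s : seq I) (f : I -> set T),
     [/\ uniq s, forall i, i \in s -> S i /\ F i (f i) &
         A = \bigcap_(i in [set` s]) f i]].

Lemma finite_meets_measurable S : finite_meets S `<=` measurable.
Proof.
move=> _ [s [f [_ sf ->]]].
apply: fin_bigcap_measurable => // i /= /sf[_]; exact: Fmeas.
Qed.

Lemma bigcup_sub_finite_meets S : \bigcup_(i in S) F i `<=` finite_meets S.
Proof.
move=> A [i Si FA]; exists [:: i], (fun=> A); split => //.
  by move=> j; rewrite inE => /eqP ->.
rewrite eqEsubset; split => x //=; first by move=> Ax j _.
by apply; rewrite /= inE.
Qed.

Lemma finite_meets_setI S : setI_closed (finite_meets S).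
Proof.
move=> _ _ [s [f [us sf ->]]] [s' [f' [us' sf' ->]]].
exists (undup (s ++ s')), (fun i => (if i \in s then f i else setT) `&`
  (if i \in s' then f' i else setT)); split; first exact: undup_uniq.
  move=> i; rewrite mem_undup mem_cat => /orP iss'; split.
    by case: iss' => [/sf[]|/sf'[]].
  apply: FI; case: ifPn => [|_]; [by move=> /sf[]|exact: FT|
    by move=> /sf'[]|exact: FT].
rewrite eqEsubset; split => x.
  by move=> [h h'] i _; split; case: ifPn => // /[dup] ? ; [exact: h|exact: h'].
move=> h; split => i /= ii.
  have /h[] : [set` undup (s ++ s')] i by rewrite /= mem_undup mem_cat ii.
  by rewrite ii.
have /h[] : [set` undup (s ++ s')] i by rewrite /= mem_undup mem_cat ii orbT.
by rewrite ii.
Qed.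

Lemma prob_finite_meet (s : seq I) (f : I -> set T) :
  uniq s -> (forall i, i \in s -> F i (f i)) ->
  P (\bigcap_(i in [set` s]) f i) = (\prod_(i <- s) P (f i))%E.
Proof.
move=> us sf; have inj : injective (tnth (in_tuple s)).
  by move=> i j; move/tuple_uniqP : (us : uniq (in_tuple s)); apply.
have tn k : tnth (in_tuple s) k \in s := mem_tnth k (in_tuple s).
have := Find inj (A := fun k => f (tnth (in_tuple s) k)) (fun k => sf _ (tn k)).
rewrite (big_tnth _ _ s) => <-; congr (P _).
rewrite eqEsubset; split => x h.
  by by move=> k _; apply: h => /=; exact: tn.
move=> i /= /seq_tnthP [k ->]; exact: h.
Qed.

Lemma finite_meets_indep S1 S2 A B : S1 `&` S2 = set0 ->
  finite_meets S1 A -> finite_meets S2 B -> P (A `&` B) = (P A * P B)%E.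
Proof.
move=> S12 [s [f [us sf ->]]] [s' [f' [us' sf' ->]]].
have dis i : i \in s -> i \in s' -> False.
  move=> /sf[S1i _] /sf'[S2i _]; have : (S1 `&` S2) i by [].
  by rewrite S12.
pose h i := if i \in s then f i else f' i.
have hs : \bigcap_(i in [set` s]) f i = \bigcap_(i in [set` s]) h i.
  by apply: eq_bigcapr => i /= ii; rewrite /h ii.
have h's : \bigcap_(i in [set` s']) f' i = \bigcap_(i in [set` s']) h i.
  by apply: eq_bigcapr => i /= ii; rewrite /h; case: ifPn => // /dis /(_ ii).
have Fh i : i \in s ++ s' -> F i (h i).
  by rewrite mem_cat /h; case: ifPn => [/sf[]//|_ /= /sf'[]].
rewrite hs h's -bigcap_setU.
have -> : [set` s] `|` [set` s'] = [set` s ++ s'].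
  by apply/seteqP; split => x /=; rewrite mem_cat => /orP.
rewrite !prob_finite_meet ?big_cat//.
- by move=> i ii; apply: Fh; rewrite mem_cat ii orbT.
- by move=> i ii; apply: Fh; rewrite mem_cat ii.
- rewrite cat_uniq us us' /= andbT; apply/hasPn => i is'.
  by apply/negP => /dis /(_ is').
Qed.

(** For fixed [B], both sides are finite measures of [A]: the restriction of [P] to [B], and [P]
    scaled by [P B]. They agree on a pi-system. Using this once in each argument proves
    [indep_sigma]. *)
Lemma sigma_indep_finite_meet S1 (A B : set T) :
  measurable B ->
  (forall A, finite_meets S1 A -> P (A `&` B) = (P A * P B)%E) ->
  <<s \bigcup_(i in S1) F i >> A -> P (A `&` B) = (P A * P B)%E.
Proof.
move=> mB h sA.
have Bfin : P B \is a fin_num by exact: fin_num_measure.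
pose b := NngNum (fine_ge0 (measure_ge0 P B)).
suff : mrestr P mB A = mscale b P A.
  by rewrite /mrestr /mscale/= => ->; rewrite fineK// muleC.
apply: (@g_sigma_algebra_measure_unique _ _ _ (finite_meets S1)
  (@finite_meets_measurable S1) (fun=> setT)) => //.
- move=> _; exists [::], (fun=> setT); split => //.
  by rewrite (_ : [set` [::]] = set0) ?bigcap_set0//; apply/seteqP; split.
- by rewrite bigcup_const//; exists 0%N.
- exact: finite_meets_setI.
- move=> A' /h hA'; rewrite [LHS]hA' /= /mscale/= fineK//; exact: muleC.
- move=> _; rewrite /= /mrestr setTI.
  by rewrite (le_lt_trans (probability_le1 P mB))// ltry.
- apply: smallest_sub sA; first exact: smallest_sigma_algebra.
  by apply: subset_trans (@bigcup_sub_finite_meets S1) _; exact: sub_sigma_algebra.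
Qed.

Lemma indep_sigma (S1 S2 : set I) (A B : set T) : S1 `&` S2 = set0 ->
  <<s \bigcup_(i in S1) F i >> A -> <<s \bigcup_(i in S2) F i >> B ->
  P (A `&` B) = (P A * P B)%E.
Proof.
move=> S12 sA sB.
have mF S : \bigcup_(i in S) F i `<=` measurable.
  by move=> C [i _]; exact: Fmeas.
have ms S C : <<s \bigcup_(i in S) F i >> C -> measurable C.
  apply: smallest_sub; last exact: mF.
  exact: sigma_algebra_measurable.
apply: sigma_indep_finite_meet (ms _ _ sB) _ sA => A' fA'.
rewrite setIC muleC; apply: sigma_indep_finite_meet sB.
  exact: finite_meets_measurable fA'.
move=> B' fB'; rewrite setIC muleC; exact: finite_meets_indep S12 fA' fB'.
Qed.

End IndependentSigmaAlgebras.

(* Unlike [ge0_le_integral], no measurability is required. *)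
Lemma le_integral_ge0 d (T : measurableType d) (R : realType)
    (mu : {measure set T -> \bar R}) (f g : T -> \bar R) :
  (forall x, 0 <= f x)%E -> (forall x, f x <= g x)%E ->
  (\int[mu]_x f x <= \int[mu]_x g x)%E.
Proof.
move=> f0 fg; rewrite !ge0_integralTE//; last first.
  by move=> x; exact: le_trans (f0 x) (fg x).
apply: ge_ereal_sup => _ [h hf] <-; apply: ereal_sup_ubound; exists h => // x.
exact: le_trans (hf x) (fg x).
Qed.

Section Freezing.
Context d (T : measurableType d) (R : realType) (P : probability T R).
Variables G1 G2 : set (set T).
Hypothesis mG1 : G1 `<=` measurable.
Hypothesis mG2 : G2 `<=` measurable.
Hypothesis indep : forall A B, <<s G1 >> A -> <<s G2 >> B ->
  P (A `&` B) = (P A * P B)%E.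
Local Notation T1 := (g_sigma_algebraType G1).
Local Notation T2 := (g_sigma_algebraType G2).

Lemma id_sigma_measurable (G : set (set T)) : G `<=` measurable ->
  measurable_fun setT (id : T -> g_sigma_algebraType G).
Proof.
move=> mG _ A mA; rewrite setTI preimage_id.
apply: smallest_sub mA; last exact: mG.
exact: sigma_algebra_measurable.
Qed.

Lemma diag_measurable : measurable_fun setT ((fun w => (w, w)) : T -> T1 * T2).
Proof.
by apply/measurable_fun_pairP; split; exact: id_sigma_measurable.
Qed.

(** The sample space, equipped with two independent sub-sigma-algebras, serves as both factors of a
    product. Independence says that the diagonal pushes [P] to the product law, and Tonelli does the
    rest. Conditioning on part of the noise thus means duplicating the sample point. *)
Lemma freeze (f : T1 * T2 -> \bar R) : measurable_fun setT f ->
  (forall z, 0 <= f z)%E ->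
  (\int[P]_w f (w, w) = \int[P]_w \int[P]_w' f (w, w'))%E.
Proof.
move=> mf f0.
have m1 := id_sigma_measurable mG1.
have m2 := id_sigma_measurable mG2.
pose h1 := isMeasurableFun.Build _ _ _ _ _ m1.
pose f1 : {mfun T >-> T1} := HB.pack (id : T -> T1) h1.
pose h2 := isMeasurableFun.Build _ _ _ _ _ m2.
pose f2 : {mfun T >-> T2} := HB.pack (id : T -> T2) h2.
pose h3 := isMeasurableFun.Build _ _ _ _ _ diag_measurable.
pose f3 : {mfun T >-> (T1 * T2)%type} := HB.pack ((fun w => (w, w)) : T -> T1 * T2) h3.
pose P1 : probability T1 R := distribution P f1.
pose P2 : probability T2 R := distribution P f2.
pose P3 : probability (T1 * T2)%type R := distribution P f3.
have P123 X : measurable X -> (P1 \x P2)%E X = P3 X.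
  apply: product_measure_unique => A B mA mB.
  exact: indep.
transitivity (\int[P3]_z f z)%E.
  by rewrite ge0_integral_pushforward.
transitivity (\int[(P1 \x P2)%E]_z f z)%E.
  by apply/esym/eq_measure_integral => A mA _; exact: P123.
rewrite fubini_tonelli1//= /fubini_F.
rewrite (ge0_integral_pushforward m1)//=.
- apply: eq_integral => w _ /=.
  rewrite (ge0_integral_pushforward m2)//=.
  exact: measurableT_comp mf (measurable_pair1 _).
- exact: measurable_fun_fubini_tonelli_F.
- by move=> w _; exact: integral_ge0.
Qed.

End Freezing.

(** * Exploration of the cluster of the root *)

(* [None] is the root marker, [Some e] an endpoint of the edge [e]. *)
Definition marker : Type := option edge.

Definition mchoice (R : realType) (W : noise R) (a : marker) : vertex -> bool :=
  if a is Some e then edge_choice W e else root_choice W.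

Definition fresh (x : vertex) (i : nat) : marker := Some (inr (x, i)).

Definition fresh_edges (x : vertex) (n : nat) : seq marker :=
  [seq fresh x i | i <- iota 0 n].

Section Exploration.
Variable R : realType.
Implicit Types (W : noise R) (x : vertex) (a : marker) (A : seq marker) (u : R).

(* If [A] lists the edges leaving the block of [x], these leave the block of
   the offspring of [x] that carries [a]. *)
Definition inherited W x a A : seq marker :=
  [seq e <- A | mchoice W e x == mchoice W a x] ++
  fresh_edges x (new_edges W x).

(** Here and in [reach_step] the recursive calls are parameters, so that the split of [x] and the
    later splits can read two different noises. This is the form in which the first split is
    frozen. *)
Definition touch_step W x a A u (F : bool -> seq marker -> R -> Prop) : Prop :=
  A <> [::] /\ (u < lifetime W x \/ (lifetime W x <= u /\
    F (mchoice W a x) (inherited W x a A) (u - lifetime W x))).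

(* Every ancestor of the position of [a], from [x] (of age [u]) on, has an edge
   leaving the set of its descendants; [n] bounds the number of generations. *)
Fixpoint touches n W x a A u : Prop :=
  if n is n'.+1 then touch_step W x a A u
    (fun b A' u' => touches n' W (child x b) a A' u')
  else False.

(** The second alternative does not record in which half [a] lies: a path that exits through
    [fresh x i] and comes back through another new edge also satisfies it. The followed marker is
    removed from its own target list, since its choices are independent only of those of other
    markers. *)
Definition reach_step W (b : bool) x a u (F : marker -> R -> Prop)
    (H : marker -> seq marker -> R -> Prop) : Prop :=
  lifetime W x <= u /\
  ((mchoice W a x = b /\ F a (u - lifetime W x)) \/
   exists2 i, (i < new_edges W x)%N & F (fresh x i) (u - lifetime W x) /\
     H (fresh x i) (a :: rem (fresh x i) (fresh_edges x (new_edges W x)))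
       (u - lifetime W x)).

(* Necessary for the descendant of [x] along [r] to be alive and linked to the
   position of [a] inside the block of [x]. A path that leaves the block of the
   offspring [child x b] first uses a new edge [fresh x i]; it ends in the other
   block, at [a], or leaves that block through another new edge. *)
Fixpoint reaches (r : seq bool) W x a u : Prop :=
  if r is b :: r' then reach_step W b x a u
    (fun a' u' => reaches r' W (child x b) a' u')
    (fun a' A' u' => exists n, touches n W (child x (~~ b)) a' A' u')
  else u < lifetime W x.

End Exploration.

(** * Genealogy of the vertices and positions of the markers *)

Definition below (w y : vertex) : Prop :=
  y.1 = w.1 /\ take (size w.2) y.2 = w.2.

Lemma below_refl w : below w w.
Proof. by split; rewrite ?take_size. Qed.

Lemma below_size w y : below w y -> (size w.2 <= size y.2)%N.
Proof. by move=> [_ <-]; rewrite size_take_min; exact: geq_minr. Qed.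

Lemma below_trans w x y : below w x -> below x y -> below w y.
Proof.
move=> /[dup] /below_size sz [wx1 wx2] [xy1 xy2]; split; first by rewrite xy1.
by rewrite -[RHS]wx2 -xy2 take_takel// xy2.
Qed.

Lemma below_child w b : below w (child w b).
Proof. by split=> //=; rewrite -cats1 take_size_cat. Qed.

Lemma below_childP w b y : below (child w b) y <->
  [/\ below w y, (size w.2 < size y.2)%N & nth false y.2 (size w.2) = b].
Proof.
split=> [cy|[[y1 y2] sy nb]].
  have [y1 /= y2] := cy.
  split; first exact: below_trans (below_child w b) cy.
    by have := below_size cy; rewrite /= size_rcons.
  by rewrite -(nth_take false (ltnSn (size w.2))) -(size_rcons w.2 b) y2
             nth_rcons ltnn eqxx.
split=> //=; rewrite size_rcons (take_nth false)// y2; congr rcons; exact: nb.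
Qed.

Lemma below_child_eq w b c y :
  below (child w b) y -> below (child w c) y -> b = c.
Proof. by move=> /below_childP[_ _ <-] /below_childP[_ _ <-]. Qed.

Lemma below_case w y : below w y -> y <> w -> exists b, below (child w b) y.
Proof.
move=> wy yw; exists (nth false y.2 (size w.2)); apply/below_childP; split=> //.
rewrite ltnNge; apply/negP => sy; apply: yw; case: wy.
rewrite take_oversize//; by case: y w {sy} => [? ?] [? ?] /= -> ->.
Qed.

Section Genealogy.
Variables (R : realType) (W : noise R) (t : R).
Implicit Types (w x y z : vertex) (c : vertex -> bool).

Definition age x : R := t - \sum_(k < size x.2) lifetime W (ancestor x k).

Definition born x : Prop :=
  forall k, (k < size x.2)%N -> split_time W (ancestor x k) <= t.

Lemma ancestor_size x : ancestor x (size x.2) = x.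
Proof. by case: x => v s; rewrite /ancestor/= take_size. Qed.

Lemma ancestor_below w y k : below w y -> (k <= size w.2)%N ->
  ancestor y k = ancestor w k.
Proof. by move=> [y1 y2] kw; rewrite /ancestor y1 -y2 take_takel. Qed.

Lemma split_timeE x :
  split_time W x = \sum_(k < size x.2) lifetime W (ancestor x k) + lifetime W x.
Proof. by rewrite /split_time big_ord_recr/= ancestor_size. Qed.

Lemma age_ltE x : (age x < lifetime W x) = (t < split_time W x).
Proof. by rewrite /age split_timeE ltrBlDl. Qed.

Lemma age_child x b : age (child x b) = age x - lifetime W x.
Proof.
rewrite /age /= size_rcons big_ord_recr/= opprD addrA; congr (_ - _ - _).
  apply: eq_bigr => k _; congr lifetime.
  by apply: ancestor_below; [exact: below_child|exact/ltnW/ltn_ord].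
congr lifetime.
by rewrite (ancestor_below (below_child x b) (leqnn _)) ancestor_size.
Qed.

Lemma born_split w y : below w y -> y <> w -> born y -> split_time W w <= t.
Proof.
move=> wy yw bo; have [b /below_childP[_ sy _]] := below_case wy yw.
by have := bo _ sy; rewrite (ancestor_below wy (leqnn _)) ancestor_size.
Qed.

Lemma split_born_child w b : born w -> split_time W w <= t -> born (child w b).
Proof.
move=> bo st k /=; rewrite size_rcons ltnS leq_eqVlt => /orP[/eqP ->|kw].
  by rewrite (ancestor_below (below_child w b) (leqnn _)) ancestor_size.
rewrite (ancestor_below (below_child w b) (ltnW kw)); exact: bo.
Qed.

Lemma split_age w : split_time W w <= t -> lifetime W w <= age w.
Proof. by rewrite leNgt -age_ltE -leNgt. Qed.

Lemma alive_antichain w y : alive W t y -> alive W t w -> below w y -> y = w.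
Proof.
move=> [bo _] [_ tw] wy; apply: contrapT => yw.
by have := born_split wy yw bo; rewrite leNgt tw.
Qed.

Definition walk c n x := iter n (fun z => child z (c z)) x.

Lemma below_walk c n x : below x (walk c n x).
Proof.
elim: n => [|n IH]; first exact: below_refl.
exact: below_trans IH (below_child _ _).
Qed.

Lemma size_walk c n x : size (walk c n x).2 = (size x.2 + n)%N.
Proof. by elim: n => [|n IH]; rewrite ?addn0// [LHS]size_rcons IH addnS. Qed.

(** Every ancestor of the end of the walk, from [s] on, is an earlier point of the walk; the one at
    the depth of [w] is [w]. *)
Lemma walk_through c n s w : below s w -> below w (walk c n s) ->
  exists m, walk c n s = walk c m w.
Proof.
move=> sw wy.
have le1 := below_size sw.
have le2 : (size w.2 <= size s.2 + n)%N.
  by rewrite -(size_walk c); exact: below_size.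
exists (n - (size w.2 - size s.2))%N.
rewrite {1}(_ : n = (n - (size w.2 - size s.2)) + (size w.2 - size s.2))%N; last first.
  by rewrite subnK// leq_subLR.
rewrite /walk iterD; congr iter; rewrite -/(walk _ _ _).
set m := (size w.2 - size s.2)%N.
have yE : below (walk c m s) (walk c n s).
  rewrite /walk (_ : n = (n - m) + m)%N ?iterD; first exact: below_walk.
  by rewrite subnK// leq_subLR.
have := size_walk c m s; rewrite {2}/m subnKC//; move: (walk c m s) yE => s' yE.
case: yE wy => + + [].
case: s' w {sw le1 le2 m} => [v1 s1] [v2 s2] /= e0 e1 e2 e3 sz.
by congr (_, _); [rewrite -e0 e2|rewrite -e1 sz e3].
Qed.

Lemma position_below c x y : position W t c x y -> below x y.
Proof. by move=> [_ [n ->]]; exact: below_walk. Qed.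

Lemma position_alive c x y : position W t c x y -> alive W t y.
Proof. by case. Qed.

Lemma position_uniq c x y y' : position W t c x y -> position W t c x y' -> y = y'.
Proof.
wlog: y y' / (size y.2 <= size y'.2)%N => [wl|].
  by case: (leqP (size y.2) (size y'.2)) => [|/ltnW] h p p';
    [exact: wl|apply/esym; exact: wl].
move=> sz [ay [n yE]] [ay' [m y'E]]; apply/esym/alive_antichain => //.
move: sz; rewrite yE y'E -!/(walk _ _ _) !size_walk leq_add2l => nm.
rewrite -(subnK nm) /walk iterD; exact: below_walk.
Qed.

(** The past of a marker can be forgotten: its position may be computed from any block containing
    it, which makes the exploration recursive. *)
Lemma position_descend c s w y : below s w -> below w y ->
  position W t c s y -> position W t c w y.
Proof.
move=> sw wy [ay [n yE]]; split=> //.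
by move: wy; rewrite yE => /(walk_through sw)[m] e; exists m.
Qed.

Lemma split_not_alive w y : split_time W w <= t -> alive W t y -> y <> w.
Proof. by move=> st [_ ty] yw; move: ty; rewrite yw ltNge st. Qed.

Lemma position_child c w y : split_time W w <= t ->
  position W t c w y -> position W t c (child w (c w)) y.
Proof.
move=> st p; have yw := split_not_alive st (position_alive p).
case: p => ay [[|n] yE]; first by rewrite yE in yw.
by split=> //; exists n; rewrite yE iterSr.
Qed.

End Genealogy.

Section ClusterCover.
Variables (R : realType) (W : noise R) (G : ngraph) (t : R).
Implicit Types (w x y z : vertex).

Local Notation full := (full_process W G t).
Local Notation alive := (alive W t).
Local Notation pos a := (position W t (mchoice W a)).

(* The block of [w] is the set of its living descendants. *)
Definition block_link w y y' : Prop :=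
  [/\ below w y, below w y' & linked full y y'].

Definition block_conn w : vertex -> vertex -> Prop :=
  clos_refl_trans vertex (block_link w).

Lemma end_alive e y : ends full e y -> alive y.
Proof.
by case: e => [e0|[x k]] /= -[] => [v _|b _]; exact: position_alive.
Qed.

Lemma block_conn_step w y z z' :
  block_conn w y z -> block_link w z z' -> block_conn w y z'.
Proof. by move=> h l; apply: rt_trans h _; exact: rt_step. Qed.

(** An initial edge has at most one end in the tree of each initial vertex, because positions are
    unique. The ends of a new edge of [x] separate exactly at the depth of [x], and the two ends
    here separate at the depth of [w]; both being below [x] and [w], this forces [x = w]. *)
Lemma crossing_edge w b e y y' : eset full e -> ends full e y -> ends full e y' ->
  below (child w b) y -> below (child w (~~ b)) y' ->
  exists i, [/\ (i < new_edges W w)%N, e = inr (w, i),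
    pos (fresh w i) (child w b) y & pos (fresh w i) (child w (~~ b)) y'].
Proof.
move=> Ee ey ey' wy wy'.
have yy' : y <> y'.
  by move=> yE; move: wy'; rewrite -yE => /(below_child_eq wy); case: (b).
have [[y1 _] _ nb] := (below_childP _ _ _).1 wy.
have [[y1' _] _ nb'] := (below_childP _ _ _).1 wy'.
case: e Ee ey ey' => [e0|[x k]] /= Ee.
  move=> [v _ p] [v' _ p']; case: yy'.
  have [/= e1 _] := position_below p; have [/= e1' _] := position_below p'.
  move: p p'; rewrite -e1 -e1' y1 y1'; exact: position_uniq.
move=> [c _ p] [c' _ p'].
have cc' : c <> c' by move=> cE; apply: yy'; move: p p'; rewrite cE; exact: position_uniq.
have [xy sx nc] := (below_childP _ _ _).1 (position_below p).
have [xy' sx' nc'] := (below_childP _ _ _).1 (position_below p').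
have [wy2 sw _] := (below_childP _ _ _).1 wy.
have [wy2' sw' _] := (below_childP _ _ _).1 wy'.
have nthT v v' n : below v v' -> (n < size v.2)%N ->
    nth false v'.2 n = nth false v.2 n.
  by move=> [_ <-] h; rewrite nth_take//; move: h; rewrite size_take_min leq_min => /andP[].
have xw : x = w.
  have sE : size x.2 = size w.2.
    case: (ltngtP (size x.2) (size w.2)) => // lt; exfalso.
      by apply: cc'; rewrite -nc -nc' (nthT _ _ _ wy2 lt) (nthT _ _ _ wy2' lt).
    by move: nb nb'; rewrite (nthT _ _ _ xy lt) (nthT _ _ _ xy' lt) => ->; case: (b).
  case: xy wy2 => [x1 x2] [w1 w2].
  case: x w x1 x2 w1 w2 sE {wy wy' p p' Ee nb nb' xy' sx sx' nc nc' wy2' sw sw' y1 y1'} =>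
    [? x2'] [? w2'] /= <- h1 <- h2 h3.
  by rewrite -h1 -h2 h3.
subst x; case: Ee => _ _ ki.
have cb : c = b by rewrite -nc nb.
have cb' : c' = ~~ b by rewrite -nc' nb'.
by exists k; split; rewrite // -?cb' -?cb.
Qed.

(** Induction along the path from [y], keeping track of its first exit [i] and then of its first
    return through some [j] other than [i]. After that return nothing more has to be followed. *)
Lemma block_conn_split w b y v : split_time W w <= t ->
  below (child w b) y -> block_conn w y v ->
  (below (child w b) v /\ block_conn (child w b) y v) \/
  exists i p q, [/\ (i < new_edges W w)%N,
    pos (fresh w i) (child w b) p, block_conn (child w b) y p,
    pos (fresh w i) (child w (~~ b)) q &
    (below (child w (~~ b)) v /\ block_conn (child w (~~ b)) q v) \/
    exists j p', [/\ (j < new_edges W w)%N, j != i,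
      pos (fresh w j) (child w (~~ b)) p' & block_conn (child w (~~ b)) q p']].
Proof.
move=> st wy yv0; have yv := clos_rt_rtn1 _ _ _ _ yv0.
elim: v / yv {yv0} => [|v1 v2 [wv1 wv2 [e Ee [ev1 ev2]]] _ IH].
  by left; split=> //; exact: rt_refl.
have [c cv2] := below_case wv2 (split_not_alive st (end_alive ev2)).
have lk w' : below w' v1 -> below w' v2 -> block_link w' v1 v2.
  by move=> ? ?; split=> //; exists e.
case: IH => [[bv1 cv1]|[i [p [q [iN pi yp qi [[bv1 cv1]|h]]]]]].
- have [cb|cb] : c = b \/ c = ~~ b by (case: (c); case: (b); auto).
    subst c; left; split=> //; exact: block_conn_step cv1 (lk _ bv1 cv2).
  subst c; right.
  have [i [iN _ pi qi]] := crossing_edge Ee ev1 ev2 bv1 cv2.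
  by exists i, v1, v2; split=> //; left; split=> //; exact: rt_refl.
- have [cb|cb] : c = b \/ c = ~~ b by (case: (c); case: (b); auto).
    subst c; have bv2 : below (child w (~~ ~~ b)) v2 by rewrite negbK.
    have [j [jN _ qj]] := crossing_edge Ee ev1 ev2 bv1 bv2.
    (* Coming back through the same edge leads to the same end [p], so the excursion can be cut out
       of the path. *)
    rewrite negbK => pj; have [ji|ji] := eqVneq j i.
      subst j; left; split=> //; by rewrite (position_uniq pj pi).
    by right; exists i, p, q; split=> //; right; exists j, v1.
  subst c; right.
  exists i, p, q; split=> //; left; split=> //.
  exact: block_conn_step cv1 (lk _ bv1 cv2).
- by right; exists i, p, q; split=> //; right.
Qed.

Lemma fresh_edgesP x n a :
  reflect (exists2 i, (i < n)%N & a = fresh x i) (a \in fresh_edges x n).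
Proof.
apply: (iffP mapP) => [[i]|[i ilt ->]].
  by rewrite mem_iota add0n => /= ilt ->; exists i.
by exists i => //; rewrite mem_iota add0n.
Qed.

(** At each split, either the path stays in the half of [z], and then [a'] was inherited by that
    half, or it first leaves through a new edge, which becomes the target. So the list of outgoing
    edges is never empty. The walk makes [n] splits, and one more check is due at [z] itself. *)
Lemma touches_of_conn n w a A z a' z' : born W t w ->
  z = walk (mchoice W a) n w -> alive z -> a' \in A -> pos a' w z' ->
  block_conn w z z' -> touches n.+1 W w a A (age W t w).
Proof.
elim: n w A z a' z' => [|n IH] w A z a' z' bo zE az aA pa' zz'.
  split; first by move=> A0; rewrite A0 in aA.
  by left; rewrite age_ltE; move: az; rewrite zE => -[].
have zE' : z = walk (mchoice W a) n (child w (mchoice W a w)).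
  by rewrite zE /walk iterSr.
have wz : below (child w (mchoice W a w)) z by rewrite zE'; exact: below_walk.
have wz0 : below w z by exact: below_trans (below_child _ _) wz.
have zw : z <> w.
  by move=> h; move/below_childP: wz => [_ + _]; rewrite h ltnn.
have st := born_split wz0 zw az.1.
split; first by move=> A0; rewrite A0 in aA.
right; split; first exact: split_age.
rewrite -(age_child W t w (mchoice W a w)).
case: (block_conn_split st wz zz') => [[wz' cz']|[i [p [q [iN pi yp _ _]]]]].
  apply: (IH _ _ z a' z') => //; first exact: split_born_child.
    rewrite mem_cat mem_filter aA andbT; apply/orP; left; apply/eqP.
    exact: below_child_eq (position_below (position_child st pa')) wz'.
  exact: position_descend (below_child _ _) wz' pa'.
apply: (IH _ _ z (fresh w i) p) => //; first exact: split_born_child.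
by rewrite mem_cat; apply/orP; right; apply/fresh_edgesP; exists i.
Qed.

(** In the half away from [y], the marker followed is the new edge through which the path enters,
    and [a] or another new edge is the target. *)
Lemma reaches_of_conn r w a y z : born W t w -> y = (w.1, w.2 ++ r) ->
  alive y -> pos a w z -> block_conn w y z -> reaches r W w a (age W t w).
Proof.
elim: r w a y z => [|b r IH] w a y z bo yE ay pa yz.
  move: yE; rewrite cats0 -surjective_pairing => yE /=.
  by rewrite age_ltE; move: ay; rewrite yE => -[].
have yE' : y = ((child w b).1, (child w b).2 ++ r) by rewrite yE /= cat_rcons.
have wy : below (child w b) y by rewrite yE'; split=> //=; rewrite take_size_cat.
have wy0 : below w y by exact: below_trans (below_child _ _) wy.
have yw : y <> w.
  by move=> h; move/below_childP: wy => [_ + _]; rewrite h ltnn.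
have st := born_split wy0 yw ay.1.
split; first exact: split_age.
rewrite -!(age_child W t w b).
case: (block_conn_split st wy yz) => [[wz cz]|[i [p [q [iN pi yp qi h]]]]].
  left; have cb := below_child_eq (position_below (position_child st pa)) wz.
  split=> //; apply: (IH _ _ y z) => //; first exact: split_born_child.
  by rewrite -cb; exact: position_child.
right; exists i => //; split.
  by apply: (IH _ _ y p) => //; exact: split_born_child.
have [aq [n qE]] := qi.
exists n.+1; rewrite age_child -(age_child W t w (~~ b)).
have born' : born W t (child w (~~ b)) by exact: split_born_child.
case: h => [[wz cz]|[j [p' [jN ji pj qp']]]].
  apply: (@touches_of_conn _ _ _ _ q a z) => //; first by rewrite mem_head.
  have cb := below_child_eq (position_below (position_child st pa)) wz.
  by rewrite -cb; exact: position_child.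
apply: (@touches_of_conn _ _ _ _ q (fresh w j) p') => //.
rewrite in_cons; apply/orP; right; rewrite mem_rem_uniq; last first.
  by rewrite map_inj_uniq ?iota_uniq// => k l [].
rewrite !inE; apply/andP; split.
  by apply/eqP => -[/eqP]; rewrite (negbTE ji).
by apply/fresh_edgesP; exists j.
Qed.

(** Both ends of a new edge lie below the same initial vertex, so the first exit from the block of
    the initial root uses an initial edge at the root. *)
Lemma reachable_block z y : alive z -> below (initial (groot G)) z ->
  reachable full z y ->
  (below (initial (groot G)) y /\ block_conn (initial (groot G)) z y) \/
  exists e0 p, [/\ eset G e0, ends G e0 (groot G),
    pos (Some (inl e0)) (initial (groot G)) p &
    block_conn (initial (groot G)) z p].
Proof.
move=> az oz zy0; have zy := clos_rt_rtn1 _ _ _ _ zy0.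
elim: y / zy {zy0} => [|v1 v2 [e Ee [ev1 ev2]] _ [[ov1 zv1]|]]; last by right.
  by left; split=> //; exact: rt_refl.
have [ov2|ov2] := pselect (below (initial (groot G)) v2).
  by left; split=> //; apply: block_conn_step zv1 _; split=> //; exists e.
right; case: e Ee ev1 ev2 => [e0|[x k]] /= Ee.
  move=> [u u0 p1] _; exists e0, v1.
  have [/= e1 _] := position_below p1; have [/= e2 _] := ov1.
  have uE : u = groot G by rewrite -e1 -e2.
  by rewrite uE in u0 p1; split.
move=> [b _ /position_below[/= e1 _]] [b' _ /position_below[/= e2 _]].
by case: ov2; split; rewrite ?take0// e2 -e1; case: ov1.
Qed.

Lemma cluster_cover y : vset (cluster_process W G t) y ->
  (exists2 r, y = (groot G, r) & reaches r W (initial (groot G)) None t) \/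
  exists e0 n, [/\ eset G e0, ends G e0 (groot G) &
    touches n W (initial (groot G)) None [:: Some (inl e0)] t].
Proof.
move=> /= [[Gy ay]]; set z := xget _ _ => rzy.
have ageE : age W t (initial (groot G)) = t by rewrite /age/= big_ord0 subr0.
have [pz|pz] := pselect (pos None (initial (groot G)) z); last first.
  (* Without a position for the root marker, the root is the default vertex, which is not alive. It
     is then an end of no edge, and its component has no living vertex. *)
  have naz : ~ alive z.
    rewrite /z; case: xgetP => [x _ px|np az]; first by case: pz; rewrite /z; case: xgetP => // /(_ x).
    by apply: (np (initial (groot G))); split=> //; exists 0%N.
  have {}rzy := clos_rt_rt1n _ _ _ _ rzy; case: rzy ay => [//|v v' [e _ [ez _]] _ _].
  by case: naz; exact: end_alive ez.
have bo : born W t (initial (groot G)) by [].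
have az := position_alive pz; have oz := position_below pz.
have bsym w v v' : block_conn w v v' -> block_conn w v' v.
  elim=> [v1 v2 [? ? [e ? [? ?]]]|v1|v1 v2 v3 _ h _ h'].
  - by apply: rt_step; split=> //; exists e.
  - exact: rt_refl.
  - exact: rt_trans h' h.
case: (reachable_block az oz rzy) => [[oy zy]|[e0 [p [Ee oe pp zp]]]].
  left; exists y.2; first by case: oy => /= <- _; case: (y).
  rewrite -ageE; apply: (reaches_of_conn bo _ ay pz (bsym _ _ _ zy)).
  by case: oy => /= <- _; case: (y).
right; have [_ [n zE]] := pz; exists e0, n.+1; split=> //.
by rewrite -ageE; apply: (touches_of_conn bo zE az (mem_head _ _) pp zp).
Qed.

End ClusterCover.

(** * The renewal equation *)

Section Density.
Context d (X : measurableType d) (R : realType).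
Variables (nu : {finite_measure set X -> \bar R})
  (mu : {sigma_finite_measure set X -> \bar R}) (p : X -> \bar R).
Hypothesis ip : mu.-integrable setT p.
Hypothesis nuE : forall A, measurable A -> nu A = (\int[mu]_(x in A) p x)%E.

(** The change of variables holds for the Radon-Nikodym derivative, which equals [p] almost
    everywhere as both have the same integrals over measurable sets. *)
Lemma integral_density (f : X -> \bar R) : measurable_fun setT f ->
  (forall x, 0 <= f x)%E -> (\int[nu]_x f x = \int[mu]_x (f x * p x))%E.
Proof.
move=> mf f0.
have dom : nu `<< mu.
  apply/null_content_dominatesP => A mA muA0; rewrite nuE//.
  by rewrite null_set_integral//; exact: measurable_funTS (measurable_int _ ip).
rewrite -(Radon_Nikodym_SigmaFinite.change_of_variables dom)//.
have ig := Radon_Nikodym_SigmaFinite.f_integrable dom.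
apply: ae_eq_integral => //.
- apply: emeasurable_funM => //; exact: measurable_int ig.
- apply: emeasurable_funM => //; exact: measurable_int ip.
apply: ae_eqe_mul2l; apply: (@integral_ae_eq _ _ _ mu) => //.
- exact: measurable_int ip.
- by move=> A AT mA; rewrite -nuE// (Radon_Nikodym_SigmaFinite.f_integral dom).
Qed.

End Density.

Section Renewal.
Variable R : realType.
Local Notation mu := lebesgue_measure.

Lemma integral_exponential (nu : {finite_measure set (measurableTypeR R) -> \bar R})
    (f : measurableTypeR R -> \bar R) :
  (forall A, measurable A -> nu A = exponential_prob 1 A) ->
  measurable_fun setT f -> (forall r, 0 <= f r)%E ->
  (\int[nu]_r f r = \int[mu]_r (f r * (exponential_pdf 1 r)%:E))%E.
Proof.
move=> nuE mf f0; apply: (@integral_density _ (measurableTypeR R) R nu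
  (@lebesgue_measure R) (EFin \o exponential_pdf 1)) => //.
exact: integrable_exponential_pdf.
Qed.

Lemma exponential_pdf_integral (f : R -> \bar R) (u : R) :
  0 <= u -> measurable_fun setT f -> (forall r, 0 <= f r)%E ->
  (\int[mu]_r (f r * (exponential_pdf 1 r)%:E) =
   \int[mu]_(r in `[0%R, u]) (f r * (expR (- r))%:E) +
   \int[mu]_(r in `]u, +oo[) (f r * (expR (- r))%:E))%E.
Proof.
move=> u0 mf f0.
have mfp : measurable_fun setT (fun r : R => (f r * (expR (- r))%:E)%E).
  apply: emeasurable_funM => //; apply/measurable_EFinP.
  apply: measurableT_comp; first exact: measurable_expR.
  exact: oppr_measurable.
transitivity (\int[mu]_(r in `[0%R, +oo[) (f r * (expR (- r))%:E))%E.
  rewrite [RHS]integral_mkcond; apply: eq_integral => r _.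
  rewrite /exponential_pdf !patchE; case: ifPn => _; last by rewrite mule0.
  by rewrite mul1r mulN1r.
rewrite -ge0_integral_setU//=.
- congr integral; apply/seteqP; split => r /=; rewrite !in_itv/= ?andbT.
    by move=> r0; rewrite r0 /=; case: (leP r u); [left|right].
  by move=> [/andP[]//|ur]; exact: le_trans u0 (ltW ur).
- exact: measurable_funTS.
- by move=> r _; rewrite mule_ge0// lee_fin expR_ge0.
- rewrite disj_set2E; apply/eqP; rewrite -subset0 => r /= [].
  by rewrite !in_itv/= andbT => /andP[_ ru]; rewrite ltNge ru.
Qed.

Lemma integral_expRN (u : R) :
  (\int[mu]_(r in `]u, +oo[) (expR (- r))%:E = (expR (- u))%:E)%E.
Proof.
rewrite integral_itv_obnd_cbnd; last first.
  by apply/measurable_funTS/measurable_EFinP; apply: measurableT_comp;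
    [exact: measurable_expR|exact: oppr_measurable].
rewrite (@ge0_continuous_FTC2y _ _ (fun r => - expR (- r)) _ 0)//.
- by rewrite sub0e EFinN oppeK.
- apply: continuous_subspaceT => r.
  by apply: continuous_comp; [exact: continuousN|exact: continuous_expR].
- rewrite -oppr0; apply: cvgN; exact: cvgr_expR.
- apply: cvgN; apply: cvg_at_right_filter.
  by apply: continuous_comp; [exact: continuousN|exact: continuous_expR].
- move=> x _; rewrite derive1E derive_val /GRing.scale/=; ring.

Qed.

(* [K] solves the renewal equation K(u) = P(L > u) + E[h(u - L); L <= u] with
   [L] exponential of rate 1: integrate (e^s K(s))' = e^s h(s). *)
Lemma renewal_integral (K h : R -> R) (u : R) : 0 <= u -> K 0 = 1 ->
  (forall s : R, is_derive s 1 K (h s - K s)) -> continuous h ->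
  (forall s, 0 <= s -> 0 <= h s) ->
  (\int[mu]_r ((if u < r then 1 else h (u - r))%:E * (exponential_pdf 1 r)%:E)
   = (K u)%:E)%E.
Proof.
move=> u0 K0 dK ch h0.
have mh : measurable_fun setT h by exact: continuous_measurable_fun.
have mf : measurable_fun setT (fun r : R => (if u < r then 1 else h (u - r))%:E).
  apply/measurable_EFinP; apply: measurable_fun_ifT => //.
    exact: measurable_fun_ltr.
  by apply: measurableT_comp => //; exact: measurable_funB.
rewrite (exponential_pdf_integral u0)//; last first.
  move=> r; rewrite lee_fin; case: ltP => // ru; apply: h0; by rewrite subr_ge0.
transitivity (\int[mu]_(r in `[0%R, u]) (h (u - r) * expR (- r))%:E +
    \int[mu]_(r in `]u, +oo[) (expR (- r))%:E)%E.
  congr (_ + _)%E; apply: eq_integral => r; rewrite inE/= in_itv/= ?andbT.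
    by move=> /andP[_ ru]; rewrite ltNge ru EFinM.
  by move=> ->; rewrite mul1e.
rewrite integral_expRN.
(* The fundamental theorem of calculus is applied on a nondegenerate interval. *)
have [->|un0] := eqVneq u 0.
  by rewrite set_itv1 integral_set1 oppr0 expR0 add0e K0.
(* Since K' = h - K, this is an antiderivative of h(u - r) exp(- r). Its boundary values give K(u) -
   exp(- u), and the tail of the exponential law supplies the missing exp(- u). *)
have dF (r : R) : is_derive r 1 (fun r => - (expR (- r) * K (u - r)))
    (h (u - r) * expR (- r)).
  have d1 := dK (u - r).
  have d2 : is_derive r 1 (fun r => u - r) (-1).
    rewrite -[X in is_derive _ _ _ X]sub0r.
    exact: (is_deriveB (is_derive_cst u r 1) (is_derive_id r 1)).
  have d3 : is_derive r 1 (fun r => K (u - r)) ((h (u - r) - K (u - r)) * -1).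
    exact: (@is_derive1_comp _ K (fun r => u - r) r _ _ d1 d2).
  have d4 : is_derive r 1 (fun r => expR (- r)) (expR (- r) * -1).
    have dN : is_derive r 1 (fun r : R => - r) (-1) := is_deriveN (is_derive_id r 1).
    exact: (@is_derive1_comp _ expR (fun r => - r) r _ _ (is_derive_expR _) dN).
  rewrite (_ : h (u - r) * expR (- r) = - (expR (- r) *: ((h (u - r) - K (u - r)) * -1)
    + K (u - r) *: (expR (- r) * -1))); last by rewrite /GRing.scale/=; ring.
  exact: (is_deriveN (is_deriveM d4 d3)).
have cF : continuous (fun r => - (expR (- r) * K (u - r))).
  move=> r; apply: differentiable_continuous; apply/derivable1_diffP.
  exact: ex_derive.
rewrite (@continuous_FTC2 _ _ (fun r => - (expR (- r) * K (u - r))))//.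
- rewrite subrr K0 subr0 oppr0 expR0 mul1r mulr1 -EFinB -EFinD; congr EFin; ring.
- by rewrite lt_neqAle eq_sym un0.
- apply: continuous_subspaceT => r; apply: cvgM.
    apply: (@continuous_comp _ _ _ (fun r => u - r) h); last exact: ch.
    by apply: cvgB; [exact: cvg_cst|exact: cvg_id].
  apply: (@continuous_comp _ _ _ (fun r : R => - r) expR); last exact: continuous_expR.
  by apply: cvgN; exact: cvg_id.
- split.
  + by move=> r _; exact: ex_derive.
  + by apply: cvg_at_right_filter; exact: cF.
  + by apply: cvg_at_left_filter; exact: cF.
- by move=> r _; rewrite derive1E; exact: derive_val.
Qed.

End Renewal.

(** * Measurability of the exploration *)

Section MeasurablePredicates.
Context d (X : measurableType d).

Lemma measurable_set_and (P Q : X -> Prop) : measurable [set z | P z] ->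
  measurable [set z | Q z] -> measurable [set z | P z /\ Q z].
Proof. exact: measurableI. Qed.

Lemma measurable_set_or (P Q : X -> Prop) : measurable [set z | P z] ->
  measurable [set z | Q z] -> measurable [set z | P z \/ Q z].
Proof. exact: measurableU. Qed.

Lemma measurable_set_not (P : X -> Prop) : measurable [set z | P z] ->
  measurable [set z | ~ P z].
Proof. exact: measurableC. Qed.

Lemma measurable_const (P : Prop) : measurable [set _ : X | P].
Proof.
have [p|p] := pselect P.
  by rewrite (_ : [set _ | P] = setT)//; apply/seteqP; split.
by rewrite (_ : [set _ | P] = set0)//; apply/seteqP; split.
Qed.

Lemma measurable_exists (I : countType) (P : I -> X -> Prop) :
  (forall i, measurable [set z | P i z]) -> measurable [set z | exists i, P i z].
Proof.
move=> mP; rewrite (_ : [set z | _] = \bigcup_i [set z | P i z]).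
  by apply: countable_bigcupT_measurable => //; exact: countableP.
by apply/seteqP; split => z [i]; exists i.
Qed.

Lemma measurable_forall (I : countType) (P : I -> X -> Prop) :
  (forall i, measurable [set z | P i z]) -> measurable [set z | forall i, P i z].
Proof.
move=> mP; rewrite (_ : [set z | _] = ~` [set z | exists i, ~ P i z]).
  apply/measurableC/measurable_exists => i; exact/measurable_set_not.
by apply/seteqP; split => z /=; rewrite -forallNP => h i;
  [rewrite notK; exact: h|exact: contrapT (h i)].
Qed.

(** On each level set of [c] the index is constant. Random vertices, lists and counts can therefore
    be treated as deterministic in every measurability proof below. *)
Lemma measurable_dep (I : countType) (c : X -> I) (P : I -> X -> Prop) :
  (forall i, measurable [set z | c z = i]) ->
  (forall i, measurable [set z | P i z]) -> measurable [set z | P (c z) z].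
Proof.
move=> mc mP; rewrite (_ : [set z | _] = [set z | exists i, c z = i /\ P i z]).
  by apply: measurable_exists => i; exact: measurable_set_and.
by apply/seteqP; split => [z h|z [i [<-]]]; first by exists (c z).
Qed.

Lemma measurable_eq_comp (I J : countType) (c : X -> I) (f : I -> J) :
  (forall i, measurable [set z | c z = i]) ->
  forall j, measurable [set z | f (c z) = j].
Proof.
move=> mc j; apply: (measurable_dep (P := fun i _ => f i = j)) => // i.
exact: measurable_const.
Qed.

Lemma measurable_eq_pair (I J : countType) (c : X -> I) (c' : X -> J) :
  (forall i, measurable [set z | c z = i]) ->
  (forall j, measurable [set z | c' z = j]) ->
  forall k, measurable [set z | (c z, c' z) = k].
Proof.
move=> mc mc' [i j]; rewrite (_ : [set z | _] = [set z | c z = i /\ c' z = j]).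
  exact: measurable_set_and.
by apply/seteqP; split => z /= [<- <-].
Qed.

End MeasurablePredicates.

Section MeasurableExploration.
Variable R : realType.

(** Stated vertex by vertex over an arbitrary space, because it is needed over the sub-sigma-algebra
    of some of the sources and over products of two such spaces, where only part of the noise is
    measurable. *)
Record measurable_noise_at d (X : measurableType d) (W : X -> noise R)
    (x : vertex) : Prop := MeasurableNoiseAt {
  measurable_lifetime : measurable_fun setT (fun z => lifetime (W z) x);
  measurable_new_edges : forall n, measurable [set z | new_edges (W z) x = n];
  measurable_mchoice : forall a b, measurable [set z | mchoice (W z) a x = b]
}.

Lemma measurable_noise_comp d d' (X : measurableType d) (Y : measurableType d')
    (f : Y -> X) (W : X -> noise R) x : measurable_fun setT f ->
  measurable_noise_at W x -> measurable_noise_at (W \o f) x.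
Proof.
move=> mf [ml mn mc]; split => [|n|a b]; first exact: measurableT_comp ml mf.
  by rewrite -[X in measurable X]setTI; exact: mf (mn n).
by rewrite -[X in measurable X]setTI; exact: mf (mc a b).
Qed.

Context d (X : measurableType d).
Implicit Types (W : X -> noise R) (u : X -> R) (x : vertex) (a : marker).

Lemma measurable_age u W x : measurable_noise_at W x ->
  measurable_fun setT u ->
  measurable_fun setT (fun z => u z - lifetime (W z) x).
Proof. by move=> [ml _ _] mu; exact: measurable_funB. Qed.

Lemma measurable_ltR (f g : X -> R) : measurable_fun setT f ->
  measurable_fun setT g -> measurable [set z | f z < g z].
Proof.
move=> mf mg; rewrite -[X in measurable X]setTI.
have := measurable_fun_ltr mf mg; move/(_ measurableT [set true] I).
by congr measurable; apply/seteqP; split => z [].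
Qed.

Lemma measurable_leR (f g : X -> R) : measurable_fun setT f ->
  measurable_fun setT g -> measurable [set z | f z <= g z].
Proof.
move=> mf mg; rewrite (_ : [set z | _] = [set z | ~ g z < f z]).
  exact/measurable_set_not/measurable_ltR.
by apply/seteqP; split => z /=; rewrite leNgt => /negP.
Qed.

Lemma measurable_inherited W x a A :
  (forall n, measurable [set z | new_edges (W z) x = n]) ->
  (forall a b, measurable [set z | mchoice (W z) a x = b]) ->
  forall A', measurable [set z | inherited (W z) x a A = A'].
Proof.
move=> mn mc.
(* The list depends on the noise only through these choices, that of [a] and the number of new
   edges: a countable-valued triple. *)
pose choices z := [seq mchoice (W z) e x | e <- A].
have mchoices s : measurable [set z | choices z = s].
  rewrite /choices {choices}; elim: A s => [|e A IH] [|b s].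
  - exact: (@measurable_const _ X ([::] = [::] :> seq bool)).
  - exact: (@measurable_const _ X ([::] = b :: s)).
  - rewrite (_ : [set z | _] = [set z | False]); first exact: measurable_const.
    by apply/seteqP; split.
  - rewrite (_ : [set z | _] = [set z | mchoice (W z) e x = b /\
      [seq mchoice (W z) e' x | e' <- A] = s]).
      exact: measurable_set_and.
    by apply/seteqP; split => z /= [<- <-].
pose g (k : seq bool * bool * nat) :=
  mask [seq c == k.1.2 | c <- k.1.1] A ++ fresh_edges x k.2.
move=> A'.
rewrite (_ : [set z | _] = [set z | g (choices z, mchoice (W z) a x,
    new_edges (W z) x) = A']).
  apply: (measurable_eq_comp (c := fun z => (choices z, mchoice (W z) a x,
    new_edges (W z) x))) => k.
  apply: (measurable_eq_pair (c := fun z => (choices z, mchoice (W z) a x))) => // k'.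
  exact: measurable_eq_pair.
by apply/seteqP; split => z /=; rewrite /inherited /g /= -map_comp -filter_mask.
Qed.

Lemma measurable_touch_step W u x a A (F : X -> bool -> seq marker -> R -> Prop) :
  measurable_noise_at W x -> measurable_fun setT u ->
  (forall b A', measurable [set z | F z b A' (u z - lifetime (W z) x)]) ->
  measurable [set z | touch_step (W z) x a A (u z) (F z)].
Proof.
move=> mW mu mF; have [ml mn mc] := mW.
apply: measurable_set_and; first exact: measurable_const.
apply: measurable_set_or; first exact: measurable_ltR.
apply: measurable_set_and; first exact: measurable_leR.
apply: (measurable_dep (P := fun b z => F z b (inherited (W z) x a A)
  (u z - lifetime (W z) x))) => [b|b]; first exact: mc.
apply: (measurable_dep (P := fun A' z => F z b A'
  (u z - lifetime (W z) x))) => [A'|A']; first exact: measurable_inherited.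
exact: mF.
Qed.

Lemma measurable_touches n W u x a A :
  (forall y, below x y -> measurable_noise_at W y) -> measurable_fun setT u ->
  measurable [set z | touches n (W z) x a A (u z)].
Proof.
elim: n u x A => [|n IH] u x A mW mu; first exact: measurable_const.
have mWx := mW x (below_refl x).
have := @measurable_touch_step W u x a A (fun z b A' (v : R) =>
  touches n (W z) (child x b) a A' v) mWx mu.
apply=> b A'; apply: (IH (fun z => u z - lifetime (W z) x)); last exact: measurable_age.
by move=> y xy; apply: mW; exact: below_trans (below_child _ _) xy.
Qed.

Lemma measurable_reach_step W u b x a (F : X -> marker -> R -> Prop)
    (H : X -> marker -> seq marker -> R -> Prop) :
  measurable_noise_at W x -> measurable_fun setT u ->
  (forall a', measurable [set z | F z a' (u z - lifetime (W z) x)]) ->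
  (forall a' A', measurable [set z | H z a' A' (u z - lifetime (W z) x)]) ->
  measurable [set z | reach_step (W z) b x a (u z) (F z) (H z)].
Proof.
move=> mW mu mF mH; have [ml mn mc] := mW.
apply: measurable_set_and; first exact: measurable_leR.
apply: measurable_set_or; first by apply: measurable_set_and; [exact: mc|exact: mF].
rewrite (_ : [set z | _] = [set z | exists i, (i < new_edges (W z) x)%N /\
  (F z (fresh x i) (u z - lifetime (W z) x) /\
   H z (fresh x i) (a :: rem (fresh x i) (fresh_edges x (new_edges (W z) x)))
     (u z - lifetime (W z) x))]); last first.
  by apply/seteqP; split => [z [i iN h]|z [i [iN h]]]; exists i.
apply: measurable_exists => i.
apply: (measurable_dep (P := fun n z => (i < n)%N /\
  (F z (fresh x i) (u z - lifetime (W z) x) /\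
   H z (fresh x i) (a :: rem (fresh x i) (fresh_edges x n))
     (u z - lifetime (W z) x)))) => n; first exact: mn.
apply: measurable_set_and; first exact: measurable_const.
by apply: measurable_set_and; [exact: mF|exact: mH].
Qed.

Lemma measurable_reaches r W u x a :
  (forall y, below x y -> measurable_noise_at W y) -> measurable_fun setT u ->
  measurable [set z | reaches r (W z) x a (u z)].
Proof.
elim: r u x a => [|b r IH] u x a mW mu; have mWx := mW x (below_refl x).
  by apply: measurable_ltR => //; exact: measurable_lifetime mWx.
have mWc c y : below (child x c) y -> measurable_noise_at W y.
  by move=> xy; apply: mW; exact: below_trans (below_child _ _) xy.
have := @measurable_reach_step W u b x a
  (fun z a' (v : R) => reaches r (W z) (child x b) a' v)
  (fun z a' A' (v : R) => exists n, touches n (W z) (child x (~~ b)) a' A' v) mWx mu.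
apply=> a'.
  apply: (IH (fun z => u z - lifetime (W z) x)); first exact: mWc.
  exact: measurable_age.
move=> A'; apply: measurable_exists => n.
apply: (@measurable_touches n W (fun z => u z - lifetime (W z) x)); first exact: mWc.
exact: measurable_age.
Qed.

End MeasurableExploration.

(** * Conditioning on disjoint sources *)

HB.instance Definition _ := gen_eqMixin source.
HB.instance Definition _ := gen_choiceMixin source.

Definition at_vertex (x : vertex) : set source := [set s |
  match s with
  | InitialGraph => False
  | Lifetime y | NewEdges y | RootChoice y | EdgeChoice _ y => y = x
  end].

Definition below_sources (x : vertex) : set source :=
  \bigcup_(y in [set y | below x y]) at_vertex y.

(** What happens at the split of [x], as opposed to when it happens; the two are independent, which
    decouples the renewal inequality. *)
Definition discrete_at (x : vertex) : set source :=
  at_vertex x `\` [set Lifetime x].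

Definition marker_source (a : marker) (x : vertex) : source :=
  if a is Some e then EdgeChoice e x else RootChoice x.

Lemma marker_source_inj x : injective (marker_source ^~ x).
Proof. by move=> [e|] [e'|] //= [->]. Qed.

Lemma marker_source_at a x : discrete_at x (marker_source a x).
Proof. by case: a => [e|]; split. Qed.

Lemma at_vertex_uniq s x y : at_vertex x s -> at_vertex y s -> x = y.
Proof. by case: s => //= [z|z|z|e z] -> ->. Qed.

Lemma below_sources_child x b : at_vertex x `&` below_sources (child x b) = set0.
Proof.
rewrite -subset0 => s [xs [y /= cy ys]]; have xy := at_vertex_uniq xs ys.
by move: cy; rewrite -xy => /below_childP[_ + _]; rewrite ltnn.
Qed.

Lemma below_sources_children x :
  at_vertex x `&` (below_sources (child x true) `|` below_sources (child x false))
  = set0.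
Proof. by rewrite setIUr !below_sources_child setU0. Qed.

Lemma below_sources_siblings x b :
  below_sources (child x b) `&` below_sources (child x (~~ b)) = set0.
Proof.
rewrite -subset0 => s [[y /= cy ys] [y' /= cy' ys']].
have := at_vertex_uniq ys ys' => yy'; subst y'.
by have := below_child_eq cy cy'; case: (b).
Qed.

Section Countable.
Context d (X : measurableType d) (R : realType).

Lemma measurable_countable_fun d' (Y : measurableType d') (I : countType)
    (c : X -> I) (f : I -> Y) :
  (forall i, measurable [set z | c z = i]) -> measurable_fun setT (fun z => f (c z)).
Proof.
move=> mc _ B mB; rewrite setTI.
apply: (measurable_dep (P := fun i _ => B (f i))) => // i.
exact: measurable_const.
Qed.

End Countable.

Section Noise.
Context (R : realType) (lambda : R).
Context d (T : measurableType d) (P : probability T R).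
Variables (M : T -> ngraph_space) (W : T -> noise R).
Hypothesis hW : cluster_noise P M W lambda.

Definition sig (S : set source) : set (set T) :=
  \bigcup_(s in S) source_events M W s.

Local Notation TS S := (g_sigma_algebraType (sig S)).

Lemma sig_measurable S : sig S `<=` measurable.
Proof. by move=> A [s _]; exact: (source_measurable hW). Qed.

Lemma sig_sub S S' : S `<=` S' -> <<s sig S >> `<=` <<s sig S' >>.
Proof.
move=> SS'; apply: sub_sigma_algebra2 => A [s Ss As]; exists s => //; exact: SS'.
Qed.

Lemma sigma_sig_measurable S A : <<s sig S >> A -> measurable A.
Proof.
apply: smallest_sub; [exact: sigma_algebra_measurable|exact: sig_measurable].
Qed.

Lemma preimage_system_setT d' (Y : measurableType d') (f : T -> Y) :
  preimage_set_system setT f measurable setT.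
Proof. by exists setT => //; rewrite preimage_setT setTI. Qed.

Lemma preimage_system_setI d' (Y : measurableType d') (f : T -> Y) :
  setI_closed (preimage_set_system setT f measurable).
Proof.
move=> _ _ [A mA <-] [B mB <-]; exists (A `&` B); first exact: measurableI.
by rewrite !setTI.
Qed.

Lemma sig_indep S1 S2 A B : S1 `&` S2 = set0 ->
  <<s sig S1 >> A -> <<s sig S2 >> B -> P (A `&` B) = (P A * P B)%E.
Proof.
apply: indep_sigma.
- by case=> [|x|x|x|e x]; exact: preimage_system_setT.
- by case=> [|x|x|x|e x]; exact: preimage_system_setI.
- exact: (source_measurable hW).
- exact: (source_independent hW).
Qed.

Lemma measurable_sig_id S : measurable_fun setT (id : T -> TS S).
Proof. exact: id_sigma_measurable (@sig_measurable S). Qed.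

Lemma sig_new_edges S x n : S (NewEdges x) ->
  <<s sig S >> [set w | new_edges (W w) x = n].
Proof.
move=> Sx; apply: sub_sigma_algebra; exists (NewEdges x) => //.
by exists [set n] => //; rewrite setTI.
Qed.

Lemma sig_mchoice S a x b : S (marker_source a x) ->
  <<s sig S >> [set w | mchoice (W w) a x = b].
Proof.
move=> Sx; apply: sub_sigma_algebra; exists (marker_source a x) => //.
by case: a Sx => [e|] _; exists [set b] => //; rewrite setTI.
Qed.

Lemma noise_at_sig S x : at_vertex x `<=` S ->
  measurable_noise_at (W : TS S -> noise R) x.
Proof.
move=> xS; split => [_ B mB|n|a b].
- by apply: sub_sigma_algebra; exists (Lifetime x); [exact: xS|exists B].
- by apply: sig_new_edges; exact: xS.
- by apply: sig_mchoice; apply: xS; case: (marker_source_at a x).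
Qed.

Lemma noise_at x : measurable_noise_at W x.
Proof.
exact: (@measurable_noise_comp _ _ _ (TS (at_vertex x)) T id W x
  (measurable_sig_id (S := at_vertex x)) (noise_at_sig (@subset_refl _ _))).
Qed.

Lemma freeze_sources S1 S2 (f : TS S1 * TS S2 -> \bar R) : S1 `&` S2 = set0 ->
  measurable_fun setT f -> (forall z, 0 <= f z)%E ->
  (\int[P]_w f (w, w) = \int[P]_w \int[P]_w' f (w, w'))%E.
Proof.
move=> S12 mf f0; apply: freeze => //; try exact: sig_measurable.
move=> A B; exact: sig_indep.
Qed.

(** The events are summed before their sections are bounded, because expected cluster sizes and
    degrees are controlled as sums, not term by term. *)
Lemma freeze_prob S1 S2 (I : Type) (s : seq I) (E : I -> set (TS S1 * TS S2))
    (g : T -> \bar R) : S1 `&` S2 = set0 -> (forall i, measurable (E i)) ->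
  (forall w : T, \sum_(i <- s) P [set w' : T | E i (w, w')] <= g w)%E ->
  (\sum_(i <- s) P [set w : T | E i (w, w)] <= \int[P]_w g w)%E.
Proof.
move=> S12 mE Eg.
pose f (z : TS S1 * TS S2) := (\sum_(i <- s) (\1_(E i) z)%:E)%E : \bar R.
have f0 z : (0 <= f z)%E by apply: sume_ge0 => i _; rewrite lee_fin.
have mf : measurable_fun setT f.
  by apply: emeasurable_sum => i; exact/measurable_EFinP/measurable_indic.
have mdiag i : measurable [set w : T | E i (w, w)].
  have := diag_measurable (@sig_measurable S1) (@sig_measurable S2).
  by move=> /(_ measurableT _ (mE i)); rewrite setTI.
have msec i w : measurable [set w' : T | E i (w, w')].
  have mp : measurable_fun setT ((fun w' => (w, w')) : TS S2 -> TS S1 * TS S2).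
    exact: measurable_pair1.
  have := measurableT_comp mp (measurable_sig_id (S := S2)).
  by move=> /(_ measurableT _ (mE i)); rewrite setTI.
have intE (A : I -> set T) : (forall i, measurable (A i)) ->
    (\int[P]_w (\sum_(i <- s) (\1_(A i) w)%:E) = \sum_(i <- s) P (A i))%E.
  move=> mA; rewrite ge0_integral_sum//.
    by apply: eq_bigr => i _; rewrite integral_indic// setIT.
  by move=> i; exact/measurable_EFinP/measurable_indic.
have indicP (A : set T) (B : set (TS S1 * TS S2)) w z : (A w <-> B z) ->
    (\1_A w)%:E = (\1_B z)%:E :> \bar R.
  by move=> AB; rewrite !indicE; congr ((nat_of_bool _)%:R%:E); apply/idP/idP; rewrite !inE => /AB.
rewrite -intE//; apply: (@le_trans _ _ (\int[P]_w f (w, w))%E).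
  apply: le_integral_ge0 => w; first by apply: sume_ge0 => i _; rewrite lee_fin.
  by rewrite /f; apply: lee_sum => i _; rewrite (indicP _ (E i) w (w, w)).
rewrite freeze_sources//; apply: le_integral_ge0 => w; first exact: integral_ge0.
by apply: le_trans (Eg w); rewrite -intE.
Qed.

Lemma integral_lifetime x (f : R -> \bar R) : measurable_fun setT f ->
  (forall r, 0 <= f r)%E ->
  (\int[P]_w f (lifetime (W w) x) =
   \int[lebesgue_measure]_r (f r * (exponential_pdf 1 r)%:E))%E.
Proof.
move=> mf f0; have ml := measurable_lifetime (noise_at x).
have ml' : measurable_fun setT ((fun w => lifetime (W w) x) : T -> measurableTypeR R).
  exact: ml.
pose h := isMeasurableFun.Build _ _ _ _ _ ml'.
pose l : {mfun T >-> measurableTypeR R} := HB.pack (fun w => lifetime (W w) x) h.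
transitivity (\int[distribution P l]_r f r)%E.
  by rewrite ge0_integral_pushforward.
apply: integral_exponential => // A mA; exact: lifetime_law hW x A mA.
Qed.

Lemma renewal_lifetime x (K h : R -> R) (u : R) : 0 <= u -> K 0 = 1 ->
  (forall s : R, is_derive s 1 K (h s - K s)) -> continuous h ->
  (forall s, 0 <= s -> 0 <= h s) ->
  (\int[P]_w (if u < lifetime (W w) x then 1 else h (u - lifetime (W w) x))%:E
   = (K u)%:E)%E.
Proof.
move=> u0 K0 dK ch h0.
rewrite -(renewal_integral u0 K0 dK ch h0).
rewrite (@integral_lifetime x (fun r => (if u < r then 1 else h (u - r))%:E))//.
  apply/measurable_EFinP; apply: measurable_fun_ifT => //.
    exact: measurable_fun_ltr.
  apply: measurableT_comp; first exact: continuous_measurable_fun.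
  exact: measurable_funB.
by move=> r; rewrite lee_fin; case: ltP => // ru; apply: h0; rewrite subr_ge0.
Qed.

(** With the lifetime frozen, the average over [Y] is at most the affine expression with [y] in
    place of [Y]; averaging over the lifetime is then the renewal identity for h = alpha + y
    beta. *)
Lemma renewal_bound x (u y : R) (Y : T -> R) (alpha beta K : R -> R) : 0 <= u ->
  measurable_fun setT (Y : TS (discrete_at x) -> R) -> (forall w, 0 <= Y w) ->
  (\int[P]_w (Y w)%:E <= y%:E)%E ->
  continuous alpha -> continuous beta ->
  (forall s, 0 <= alpha s) -> (forall s, 0 <= beta s) ->
  K 0 = 1 -> (forall s : R, is_derive s 1 K (alpha s + y * beta s - K s)) ->
  (\int[P]_w (if (u < lifetime (W w) x)%R then 1
     else (alpha (u - lifetime (W w) x) + Y w * beta (u - lifetime (W w) x))%:E)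
   <= (K u)%:E)%E.
Proof.
move=> u0 mY Y0 Yy ca cb a0 b0 K0 dK.
have y0 : 0 <= y.
  rewrite -lee_fin; apply: le_trans Yy; apply: integral_ge0 => w _.
  by rewrite lee_fin.
pose S1 := [set Lifetime x].
have S12 : S1 `&` discrete_at x = set0.
  by rewrite /S1 /discrete_at setDE setICA setICr setI0.
have ml : measurable_fun setT (fun w : TS S1 => lifetime (W w) x).
  move=> _ B mB; apply: sub_sigma_algebra; exists (Lifetime x) => //.
  by exists B.
have ml1 : measurable_fun setT
    (fun z : TS S1 * TS (discrete_at x) => lifetime (W z.1) x).
  exact: measurableT_comp ml measurable_fst.
have mY2 : measurable_fun setT (fun z : TS S1 * TS (discrete_at x) => Y z.2).
  exact: measurableT_comp mY measurable_snd.
pose f (z : TS S1 * TS (discrete_at x)) : \bar R :=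
  (if u < lifetime (W z.1) x then 1
   else alpha (u - lifetime (W z.1) x) + Y z.2 * beta (u - lifetime (W z.1) x))%:E.
have cm (g : R -> R) : continuous g -> measurable_fun setT
    (fun z : TS S1 * TS (discrete_at x) => g (u - lifetime (W z.1) x)).
  move=> cg; apply: measurableT_comp; first exact: continuous_measurable_fun.
  exact: measurable_funB.
have mf : measurable_fun setT f.
  apply/measurable_EFinP; apply: measurable_fun_ifT => //.
    exact: measurable_fun_ltr.
  by apply: measurable_funD; [exact: cm|apply: measurable_funM => //; exact: cm].
have f0 z : (0 <= f z)%E.
  by rewrite lee_fin; case: ifP => // _; rewrite addr_ge0// mulr_ge0.
rewrite (_ : (\int[P]_w _)%E = (\int[P]_w f (w, w))%E); last first.
  by apply: eq_integral => w _; rewrite /f /=; case: ifP.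
rewrite freeze_sources//.
have ch : continuous (fun s => alpha s + y * beta s).
  move=> s; apply: cvgD; first exact: ca.
  by apply: cvgM; [exact: cvg_cst|exact: cb].
rewrite -(renewal_lifetime x u0 K0 dK ch); last first.
  by move=> s _; rewrite addr_ge0// mulr_ge0.
have ml0 := measurable_lifetime (noise_at x).
apply: le_integral_ge0 => w; first exact: integral_ge0.
rewrite /f /=; case: ifPn => [_|]; first by rewrite integral_cst//= probability_setT mule1.
rewrite -leNgt => lu; set s := u - _.
rewrite (eq_integral (fun w' => (alpha s)%:E + (beta s)%:E * (Y w')%:E)%E);
  last by move=> w' _; rewrite EFinD EFinM [in RHS]muleC.
have mYT : measurable_fun setT (fun w => (Y w)%:E).
  apply/measurable_EFinP.
  exact: measurableT_comp mY (measurable_sig_id (S := discrete_at x)).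
rewrite ge0_integralD//; [|by move=> w' _; rewrite lee_fin|
  by move=> w' _; rewrite mule_ge0 ?lee_fin|exact: measurable_funeM].
rewrite integral_cst//= probability_setT mule1 ge0_integralZl//; last 2 first.
  by move=> w' _; rewrite lee_fin.
  by rewrite lee_fin.
rewrite EFinD leeD2l// EFinM muleC lee_wpmul2r// lee_fin; exact: b0.
Qed.
End Noise.

(** * The Lyapunov function and its contraction *)

Section Weight.
Variables (R : realType) (eps : R).

(* A Lyapunov function for the number of edges leaving the block of the
   ancestor of a marker: at each split this number [D] becomes
   [Bin(D, 1/2) + Po(lambda / 2)], and the exploration stops at [0]. *)
Definition weight (n : nat) : R := if n is 0 then 0 else 1 + eps * n%:R.

Hypothesis eps0 : 0 < eps.

Lemma weight_ge0 n : 0 <= weight n.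
Proof. by case: n => //= n; rewrite addr_ge0// mulr_ge0// ltW. Qed.

Lemma weight_ge1 n : (0 < n)%N -> 1 <= weight n.
Proof. by case: n => //= n _; rewrite lerDl mulr_ge0// ltW. Qed.

Lemma weight_le n : weight n <= 1 + eps * n%:R.
Proof. by case: n => //=; rewrite mulr0 addr0. Qed.

End Weight.

(* [q = exp (- lambda / 2)] is the probability of adding no edge. Small degrees
   are controlled by the chance [q * 2^-k] of losing all edges, large ones by
   the halving of the degree. *)
Lemma contraction_exists (R : realType) (lambda q : R) : 0 < lambda -> 0 < q <= 1 ->
  exists eps c : R, [/\ 0 < eps, 0 < c < 1 & forall k, (0 < k)%N ->
    1 + eps * (k%:R / 2 + lambda / 2) - q * 2^-1 ^+ k <=
      (1 - c) * weight eps k].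
Proof.
move=> l0 /andP[q0 q1].
(* Threshold between the regimes. Beyond [2 * lambda] the arrivals add at most eps k / 4 to the mean
   eps k / 2, which leaves a gain of eps k / 4. *)
pose m := Num.bound (2 * lambda).
have m2l : 2 * lambda <= m%:R by apply/ltW/archi_boundP; rewrite mulr_ge0// ltW.
pose h := q * 2^-1 ^+ m.
have h0 : 0 < h by rewrite mulr_gt0// exprn_gt0.
(* For k at most [m], the chance of losing all edges is at least [h], and this choice makes the
   arrivals cost eps lambda / 2 = h / 2, so that half of [h] remains. *)
pose eps := h / lambda.
have e0 : 0 < eps by rewrite divr_gt0.
have el : eps * lambda = h by rewrite /eps mulfVK// gt_eqF.
(* The three bounds serve the small degrees, the large degrees and [c < 1]. *)
pose c := Num.min (h / (2 * (1 + eps * m%:R))) (Num.min (eps / (4 * (1 + eps))) 2^-1).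
have c0 : 0 < c.
  rewrite !lt_min; apply/and3P; split => //.
    by rewrite divr_gt0// mulr_gt0// addr_gt0// mulr_gt0.
  by rewrite divr_gt0// mulr_gt0// addr_gt0.
exists eps, c; split => //.
  rewrite c0 /= /c !gt_min; apply/orP; right; apply/orP; right; lra.
have c1 : c * (1 + eps * m%:R) <= h / 2.
  have : c <= h / (2 * (1 + eps * m%:R)) by rewrite /c ge_min lexx.
  rewrite ler_pdivlMr; last by rewrite mulr_gt0// addr_gt0// mulr_gt0.
  by rewrite mulrCA [2 * _]mulrC -ler_pdivlMr.
have c2 : c * (1 + eps) <= eps / 4.
  have : c <= eps / (4 * (1 + eps)) by rewrite /c !ge_min lexx orbT.
  rewrite ler_pdivlMr; last by rewrite mulr_gt0// addr_gt0.
  by rewrite mulrCA [4 * _]mulrC -ler_pdivlMr.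
move=> [//|k] _; set n := k.+1; rewrite /weight/= -/n.
have n1 : 1 <= n%:R :> R by rewrite ler1n.
case: (leqP n m) => nm.
  have hn : h <= q * 2^-1 ^+ n.
    rewrite ler_pM2l// ler_wiXn2l// invf_le1//; lra.
  have nmR : n%:R <= m%:R :> R by rewrite ler_nat.
  have : c * (1 + eps * n%:R) <= c * (1 + eps * m%:R).
    by rewrite ler_pM2l// lerD2l ler_pM2l.
  have : 0 <= eps * n%:R by rewrite mulr_ge0// ltW.
  nra.
have nmR : m%:R <= n%:R :> R by rewrite ler_nat ltnW.
have : 0 <= q * 2^-1 ^+ n by rewrite mulr_ge0// ?exprn_ge0// ltW.
have : c * (1 + eps * n%:R) <= c * (1 + eps) * n%:R.
  rewrite -mulrA ler_pM2l// mulrDl mul1r lerD2r//.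
have : c * (1 + eps) * n%:R <= eps / 4 * n%:R by rewrite ler_wpM2r//; lra.
have : eps * lambda <= eps * (n%:R / 2) by rewrite ler_pM2l//; lra.
nra.
Qed.

Lemma nneseries_le (R : realType) (u : nat -> \bar R) (b : \bar R) :
  (forall k, 0 <= u k)%E -> (forall n, \sum_(0 <= k < n) u k <= b)%E ->
  (\sum_(k <oo) u k <= b)%E.
Proof.
move=> u0 ub; apply: lime_le; first exact: is_cvg_nneseries.
by apply: nearW => n; exact: ub.
Qed.

(** * Moments of the Poisson number of new edges *)

Section NewEdges.
Context (R : realType) (lambda : R) (hlambda : 0 < lambda).
Context d (T : measurableType d) (P : probability T R).
Variables (M : T -> ngraph_space) (W : T -> noise R).
Hypothesis hW : cluster_noise P M W lambda.
Local Notation TS S := (g_sigma_algebraType (sig M W S)).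
Let m := lambda / 2.

Lemma integral_new_edges x (f : nat -> R) : (forall n, 0 <= f n) ->
  (\int[P]_w (f (new_edges (W w) x))%:E =
   \sum_(k <oo) (f k * poisson_pmf m k)%:E)%E.
Proof.
move=> f0.
have mN := measurable_new_edges (noise_at hW x).
pose E k := [set w | new_edges (W w) x = k].
have ET : \bigcup_k E k = setT by apply/seteqP; split => // w _; exists (new_edges (W w) x).
have tE : trivIset setT E.
  apply/trivIsetP => i j _ _ ij; rewrite -subset0 => w [/= wi wj].
  by move: ij; rewrite -wi -wj eqxx.
rewrite -ET ge0_integral_bigcup//; [|rewrite ET|by move=> w _; rewrite lee_fin];
  last by apply/measurable_EFinP; exact: (measurable_countable_fun f mN).
apply: eq_eseriesr => k _.
rewrite (eq_integral (fun=> (f k)%:E)); last by move=> w; rewrite inE /E /= => ->.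
rewrite integral_cst; last exact: mN.
by rewrite EFinM -(new_edges_law hW x k).
Qed.

Lemma poisson_pmf_sum n : \sum_(k < n) poisson_pmf m k <= 1.
Proof.
have /= := @integral_new_edges (initial 0) (fun=> 1) (fun=> ler01).
rewrite integral_cst//= probability_setT mule1 -lee_fin => ->.
rewrite -sumEFin -(big_mkord xpredT (fun k => (poisson_pmf m k)%:E)).
under eq_eseriesr do rewrite mul1r.
by apply: nneseries_lim_ge => k _; rewrite lee_fin poisson_pmf_ge0.
Qed.

(** A factor [k] is traded for [m] and a shift of the index, so the first two moments reduce to the
    total mass. *)
Lemma poisson_pmfS k : k.+1%:R * poisson_pmf m k.+1 = m * poisson_pmf m k.
Proof.
have m0 : 0 < m by rewrite divr_gt0.
rewrite /poisson_pmf m0 factS natrM exprS; field.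
by rewrite pnatr_eq0 -lt0n fact_gt0 addrC natr1 pnatr_eq0.
Qed.

Lemma poisson_sum1 n : \sum_(k < n) k%:R * poisson_pmf m k <= m.
Proof.
have m0 : 0 <= m by rewrite ltW// divr_gt0.
case: n => [|n]; first by rewrite big_ord0.
rewrite big_ord_recl mul0r add0r.
under eq_bigr do rewrite lift0 poisson_pmfS.
by rewrite -mulr_sumr -[leRHS]mulr1 ler_wpM2l// poisson_pmf_sum.
Qed.

Lemma poisson_sum2 n : \sum_(k < n) k%:R ^+ 2 * poisson_pmf m k <= m * (m + 1).
Proof.
have m0 : 0 <= m by rewrite ltW// divr_gt0.
case: n => [|n]; first by rewrite big_ord0 mulr_ge0// addr_ge0.
rewrite big_ord_recl expr0n mul0r add0r.
under eq_bigr do rewrite lift0 expr2 -mulrA poisson_pmfS mulrCA -natr1 mulrDl mul1r.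
rewrite -mulr_sumr ler_wpM2l// big_split /= lerD//; first exact: poisson_sum1.
exact: poisson_pmf_sum.
Qed.

Lemma expectation_new_edges x : (\int[P]_w (new_edges (W w) x)%:R%:E <= m%:E)%E.
Proof.
rewrite (integral_new_edges x (f := fun n => n%:R))//; apply: nneseries_le => [k|n].
  by rewrite lee_fin mulr_ge0// poisson_pmf_ge0.
by rewrite big_mkord sumEFin lee_fin poisson_sum1.
Qed.

Lemma expectation_new_edges_sqr x :
  (\int[P]_w ((new_edges (W w) x)%:R ^+ 2)%:E <= (m * (m + 1))%:E)%E.
Proof.
rewrite (integral_new_edges x (f := fun n => n%:R ^+ 2))//.
apply: nneseries_le => [k|n].
  by rewrite lee_fin mulr_ge0 ?sqr_ge0// poisson_pmf_ge0.
by rewrite big_mkord sumEFin lee_fin poisson_sum2.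
Qed.

End NewEdges.

(** * Decay of the connection probability *)

(** An edge that was not created in the block of [x] cannot reappear among the fresh edges of later
    splits there, so its choices stay independent of theirs. *)
Definition external (a : marker) (x : vertex) : Prop :=
  if a is Some (inr (y, _)) then ~ below x y else True.

Lemma external_child a x b : external a x -> external a (child x b).
Proof.
case: a => [[//|[y k]]|//] /= xy cy; apply: xy.
exact: below_trans (below_child x b) cy.
Qed.

Lemma external_fresh a x i : external a x -> a <> fresh x i.
Proof. by move=> + ax; rewrite ax => /=; apply; exact: below_refl. Qed.

Lemma fresh_external x i b : external (fresh x i) (child x b).
Proof. by move=> /= /below_childP[_ + _]; rewrite ltnn. Qed.

Lemma inherited_notin (R : realType) (W : noise R) x a A : external a x ->
  a \notin A -> a \notin inherited W x a A.
Proof.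
move=> ax aA; rewrite mem_cat mem_filter negb_or negb_and aA orbT /=.
by apply/fresh_edgesP => -[i _]; exact: external_fresh.
Qed.

Section TouchBound.
Context (R : realType) (lambda : R) (hlambda : 0 < lambda).
Context d (T : measurableType d) (P : probability T R).
Variables (M : T -> ngraph_space) (W : T -> noise R).
Hypothesis hW : cluster_noise P M W lambda.
Local Notation TS S := (g_sigma_algebraType (sig M W S)).
Local Notation q := (expR (- (lambda / 2))).

Lemma mchoice_law a x b : P [set w | mchoice (W w) a x = b] = (2^-1)%:E.
Proof. by case: a => [e|]; [exact: edge_choice_law hW e x b|exact: root_choice_law hW x b]. Qed.

Lemma no_new_edges_law x : P [set w | new_edges (W w) x = 0%N] = q%:E.
Proof.
rewrite (new_edges_law hW) /poisson_pmf divr_gt0// expr0 fact0 invr1.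
by rewrite !mul1r.
Qed.

Lemma sig1_mchoice a x b :
  <<s sig M W [set marker_source a x] >> [set w | mchoice (W w) a x = b].
Proof. by apply: sig_mchoice. Qed.

Lemma sig1_new_edges x n :
  <<s sig M W [set NewEdges x] >> [set w | new_edges (W w) x = n].
Proof. by apply: sig_new_edges. Qed.

Definition avoids (x : vertex) (b : bool) (A : seq marker) : set T :=
  [set w | forall e, e \in A -> mchoice (W w) e x <> b].

Lemma avoids_cons x b e A :
  avoids x b (e :: A) = [set w | mchoice (W w) e x = ~~ b] `&` avoids x b A.
Proof.
apply/seteqP; split => w /=.
  move=> h; split; last by move=> e' eA; apply: h; rewrite in_cons eA orbT.
  by have := h e (mem_head _ _); case: (mchoice _ _ _); case: (b).
move=> [h h'] e'; rewrite in_cons => /orP[/eqP -> |]; last exact: h'.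
by rewrite h; case: (b).
Qed.

Lemma avoids_bound x b A (S : set source) (B : set T) : <<s sig M W S >> B ->
  (forall e, e \in A -> ~ S (marker_source e x)) ->
  (P B * (2^-1 ^+ size A)%:E <= P (B `&` avoids x b A))%E.
Proof.
elim: A S B => [|e A IH] S B sB SA.
  rewrite expr0 mule1 (_ : avoids x b [::] = setT) ?setIT//.
  by apply/seteqP; split.
have [eA|eA] := boolP (e \in A).
  rewrite (_ : avoids x b (e :: A) = avoids x b A).
    apply: (@le_trans _ _ (P B * (2^-1 ^+ size A)%:E)%E).
      by rewrite lee_wpmul2l// lee_fin /= exprS ler_piMl ?exprn_ge0//; lra.
    by apply: IH sB _ => e' e'A; apply: SA; rewrite in_cons e'A orbT.
  by rewrite avoids_cons setIidr// => w /(_ e eA) /=; case: (mchoice _ _ _); case: (b).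
rewrite avoids_cons setIA.
pose S' := S `|` [set marker_source e x].
pose B' := B `&` [set w | mchoice (W w) e x = ~~ b].
have Se : S `&` [set marker_source e x] = set0.
  by rewrite -subset0 => s [Ss /= se]; apply: (SA e (mem_head _ _)); rewrite -se.
have PB' : P B' = (P B * (2^-1)%:E)%E.
  rewrite (sig_indep hW Se sB (@sig1_mchoice e x (~~ b))).
  by congr (_ * _)%E; exact: mchoice_law.
have := IH S' B'; rewrite PB' -muleA -EFinM -exprS; apply.
  have SS' : S `<=` S' by move=> s; left.
  apply: (@measurableI _ (TS S')); first exact: (sig_sub SS' sB).
  by apply: sig_mchoice; right.
move=> e' e'A [|/marker_source_inj ee']; first by apply: SA; rewrite in_cons e'A orbT.
by rewrite -ee' e'A in eA.
Qed.

(** The list becomes empty when no edge is added and all of [A] goes to the side not taken by [a].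
    Each of the two choices of [a] contributes q / 2 times 2^-|A|. *)
Lemma inherited_nil_prob x a A : a \notin A ->
  ((q * 2^-1 ^+ size A)%:E <= P [set w | inherited (W w) x a A = [::]])%E.
Proof.
move=> aA.
pose S := [set NewEdges x] `|` [set marker_source a x].
pose B b := [set w | new_edges (W w) x = 0%N] `&` [set w | mchoice (W w) a x = b].
have sB b : <<s sig M W S >> (B b).
  apply: (@measurableI _ (TS S)); first by apply: sig_new_edges; left.
  by apply: sig_mchoice; right.
have PB b : P (B b) = (q * 2^-1)%:E.
  have Sd : [set NewEdges x] `&` [set marker_source a x] = set0.
    by rewrite -subset0 => s [/= ->]; case: (a).
  rewrite (sig_indep hW Sd (@sig1_new_edges x 0%N) (@sig1_mchoice a x b)).
  by rewrite EFinM; congr (_ * _)%E; [exact: no_new_edges_law|exact: mchoice_law].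
have SA e : e \in A -> ~ S (marker_source e x).
  move=> eA [|/marker_source_inj ea]; first by case: (e).
  by rewrite -ea eA in aA.
have mav b : measurable (B b `&` avoids x b A).
  apply: measurableI; first exact: (sigma_sig_measurable hW (sB b)).
  elim: (A) => [|e A' IH].
    by rewrite (_ : avoids x b [::] = setT)//; apply/seteqP; split.
  rewrite avoids_cons; apply: measurableI => //.
  exact: measurable_mchoice (noise_at hW x) _ _.
have := avoids_bound true (sB true) SA; have := avoids_bound false (sB false) SA.
rewrite !PB => h1 h2.
apply: (@le_trans _ _ (P ((B true `&` avoids x true A) `|` (B false `&` avoids x false A)))).
  rewrite measureU//; last first.
    by rewrite -subset0 => w [[[_ /= e1] _] [[_ /= e2] _]]; rewrite e1 in e2.
  apply: le_trans (leeD h2 h1); rewrite -!EFinM -EFinD lee_fin; lra.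
apply: le_measure; rewrite ?inE; first exact: measurableU.
  apply: measurable_inherited; first exact: measurable_new_edges (noise_at hW x).
  exact: measurable_mchoice (noise_at hW x).
suff key b w : (B b `&` avoids x b A) w -> inherited (W w) x a A = [::].
  by move=> w [/key|/key].
move=> [[/= N0 ab] av]; rewrite /inherited N0 cats0.
apply/eqP; rewrite -size_eq0 size_filter -leqn0 leqNgt -has_count.
by apply/hasPn => e /av; rewrite ab => /eqP.
Qed.

Lemma mchoice_eq_prob x a e : e != a ->
  (\int[P]_w (nat_of_bool (mchoice (W w) e x == mchoice (W w) a x))%:R%:E = (2^-1)%:E)%E.
Proof.
move=> ea.
pose C (c : marker) b := [set w | mchoice (W w) c x = b].
have mC c b : measurable (C c b) by exact: measurable_mchoice (noise_at hW x) _ _.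
have PC b : P (C e b `&` C a b) = (2^-1 * 2^-1)%:E.
  have Sd : [set marker_source e x] `&` [set marker_source a x] = set0.
    rewrite -subset0 => s [/= ->] /marker_source_inj ea'.
    by rewrite ea' eqxx in ea.
  rewrite (sig_indep hW Sd (@sig1_mchoice e x b) (@sig1_mchoice a x b)).
  by rewrite EFinM; congr (_ * _)%E; exact: mchoice_law.
pose D := (C e true `&` C a true) `|` (C e false `&` C a false).
have mD : measurable D by apply: measurableU; exact: measurableI.
rewrite (eq_integral (fun w => (\1_D w)%:E)).
  have mI b : measurable (C e b `&` C a b) by exact: measurableI.
  rewrite integral_indic// setIT /D measureU//; last first.
    rewrite -subset0 => w [[+ _] [+ _]]; by rewrite /C /= => ->.
  by have := PC true; have := PC false => /= -> ->; rewrite -EFinD; congr EFin; lra.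
move=> w _; rewrite indicE; congr ((nat_of_bool _)%:R%:E).
apply/eqP/idP; rewrite inE /D /C /=.
  by move=> ->; case: (mchoice _ a x); [left|right].
by move=> [[-> ->]|[-> ->]].
Qed.

Lemma expectation_inherited x a A : a \notin A ->
  (\int[P]_w (size (inherited (W w) x a A))%:R%:E <=
   ((size A)%:R / 2 + lambda / 2)%:E)%E.
Proof.
have [_ mn mc] := noise_at hW x.
have mN : measurable_fun setT (fun w => ((new_edges (W w) x)%:R)%:E : \bar R).
  exact: (measurable_countable_fun (fun n => (n%:R)%:E : \bar R) mn).
elim: A => [|e A IH].
  move=> _; rewrite mul0r add0r.
  under eq_integral do rewrite /inherited/= size_map size_iota.
  exact: (expectation_new_edges hlambda hW x).
rewrite in_cons negb_or => /andP[ae aA].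
pose f w : \bar R := ((nat_of_bool (mchoice (W w) e x == mchoice (W w) a x))%:R)%:E.
have mf : measurable_fun setT f.
  apply: (measurable_countable_fun (c := fun w => (mchoice (W w) e x, mchoice (W w) a x))
    (fun k => ((nat_of_bool (k.1 == k.2))%:R)%:E)).
  by apply: measurable_eq_pair.
rewrite (eq_integral (fun w => (f w + (size (inherited (W w) x a A))%:R%:E)%E)); last first.
  by move=> w _; rewrite /f -EFinD -natrD /inherited/=; case: eqP.
have ms : measurable_fun setT (fun w => (size (inherited (W w) x a A))%:R%:E : \bar R).
  apply: (measurable_countable_fun (fun s : seq marker => ((size s)%:R)%:E : \bar R)).
  exact: measurable_inherited.
rewrite ge0_integralD//; [|by move=> w _; rewrite /f lee_fin].
have -> : (\int[P]_w f w = (2^-1)%:E)%E by apply: mchoice_eq_prob; rewrite eq_sym.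
apply: le_trans (leeD2l _ (IH aA)) _.
by rewrite -EFinD lee_fin /= -natr1; lra.
Qed.

Variables eps c : R.
Hypothesis eps0 : 0 < eps.
Hypothesis contraction : forall k, (0 < k)%N ->
  1 + eps * (k%:R / 2 + lambda / 2) - q * 2^-1 ^+ k <= (1 - c) * weight eps k.

Lemma expectation_weight_inherited x a A : a \notin A -> A <> [::] ->
  (\int[P]_w (weight eps (size (inherited (W w) x a A)))%:E <=
   ((1 - c) * weight eps (size A))%:E)%E.
Proof.
move=> aA A0.
have [_ mn mc] := noise_at hW x.
have mi := measurable_inherited a A mn mc.
pose E := [set w | inherited (W w) x a A = [::]].
have mE : measurable E by exact: mi.
have ms (f : nat -> R) : measurable_fun setT
    (fun w => (f (size (inherited (W w) x a A)))%:E).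
  exact: (measurable_countable_fun (fun s : seq marker => (f (size s))%:E) mi).
(* Pointwise, weight n + 1[n = 0] = 1 + eps n: the atom at zero is exactly the gain over the affine
   function. *)
have sum : (\int[P]_w (weight eps (size (inherited (W w) x a A)))%:E + P E =
    1 + eps%:E * \int[P]_w (size (inherited (W w) x a A))%:R%:E)%E.
  have PE : P E = (\int[P]_w (\1_E w)%:E)%E by rewrite integral_indic// setIT.
  have P1 : (\int[P]_w 1 = 1)%E by rewrite integral_cst//= probability_setT mule1.
  rewrite PE -ge0_integralD; [|exact: measurableT|
    by move=> w _; rewrite lee_fin weight_ge0|exact: ms|
    by move=> w _; rewrite lee_fin|exact/measurable_EFinP/measurable_indic].
  rewrite -ge0_integralZl; [|exact: measurableT|exact: (ms (fun n => n%:R))|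
    by move=> w _; rewrite lee_fin|by rewrite lee_fin ltW].
  rewrite -P1 -ge0_integralD; [|exact: measurableT|by []|by []|
    by move=> w _; rewrite mule_ge0 ?lee_fin// ltW|
    by apply: measurable_funeM; exact: (ms (fun n => n%:R))].
  apply: eq_integral => w _; rewrite -EFinM -!EFinD; congr EFin.
  rewrite indicE; case: (boolP (w \in E)).
    by rewrite inE /E /= => -> /=; rewrite mulr0 add0r addr0.
  rewrite notin_setE /E /=; case: (inherited _ _ _ _) => //= e s _.
  by rewrite addr0.
have := inherited_nil_prob x aA; rewrite -/E => lb.
have ub := expectation_inherited x aA.
have -> : ((1 - c) * weight eps (size A))%:E =
  (((1 - c) * weight eps (size A) + q * 2^-1 ^+ size A)%:E - (q * 2^-1 ^+ size A)%:E)%E.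
  by rewrite -EFinB; congr EFin; ring.
rewrite leeBrDr//; apply: le_trans (leeD2l _ lb) _; rewrite sum.
apply: (@le_trans _ _ (1 + eps%:E * ((size A)%:R / 2 + lambda / 2)%:E)%E).
  by rewrite leeD2l// lee_wpmul2l// lee_fin ltW.
rewrite -EFinM -EFinD lee_fin.
have := contraction (k := size A); case: (A) A0 => // e s _ /(_ isT); lra.
Qed.
End TouchBound.

Section Bounds.
Context (R : realType) (lambda : R) (hlambda : 0 < lambda).
Context d (T : measurableType d) (P : probability T R).
Variables (M : T -> ngraph_space) (W : T -> noise R).
Hypothesis hW : cluster_noise P M W lambda.
Local Notation TS S := (g_sigma_algebraType (sig M W S)).
Local Notation q := (expR (- (lambda / 2))).
Variables eps c : R.
Hypothesis eps0 : 0 < eps.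
Hypothesis c01 : 0 < c < 1.
Hypothesis contraction : forall k, (0 < k)%N ->
  1 + eps * (k%:R / 2 + lambda / 2) - q * 2^-1 ^+ k <= (1 - c) * weight eps k.

Definition offspring_sources x : set source :=
  below_sources (child x true) `|` below_sources (child x false).

Lemma below_sources_offspring x b :
  below_sources (child x b) `<=` offspring_sources x.
Proof. by move=> s; case: b => h; [left|right]. Qed.

Lemma noise_below_offspring d' (X : measurableType d') x (f : X -> T) :
  measurable_fun setT (f : X -> TS (offspring_sources x)) ->
  forall b y, below (child x b) y -> measurable_noise_at (W \o f) y.
Proof.
move=> mf b y xy.
have yS : at_vertex y `<=` offspring_sources x.
  by move=> s ys; apply: (@below_sources_offspring x b); exists y.
exact: (@measurable_noise_comp R _ _ (TS (offspring_sources x)) X f W y mf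
  (noise_at_sig M W yS)).
Qed.

Lemma is_derive_expRM (a s : R) :
  is_derive s 1 (fun s => expR (a * s)) (a * expR (a * s)).
Proof.
have dl : is_derive s 1 (fun s : R => a * s) a.
  rewrite -[X in is_derive _ _ _ X]mulr1.
  exact: (is_deriveZ a (is_derive_id s 1)).
rewrite mulrC.
exact: (@is_derive1_comp _ expR (fun s => a * s) s _ _ (is_derive_expR _) dl).
Qed.

Lemma continuous_expRM (a : R) : continuous (fun s => expR (a * s)).
Proof.
move=> s; apply: differentiable_continuous; apply/derivable1_diffP.
exact: (@ex_derive _ _ _ _ _ _ _ (is_derive_expRM a s)).
Qed.

Lemma measurable_weight_inherited x a A : measurable_fun setT
  ((fun w => weight eps (size (inherited (W w) x a A))) : TS (discrete_at x) -> R).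
Proof.
have mi := @measurable_inherited R _ (TS (discrete_at x)) W x a A.
apply: (measurable_countable_fun (fun s : seq marker => weight eps (size s)) (mi _ _)).
  by move=> n; apply: sig_new_edges; split.
by move=> a' b; apply: sig_mchoice; exact: marker_source_at.
Qed.

Lemma measurable_from_sig S d' (Y : measurableType d') (f : T -> Y) :
  measurable_fun setT (f : TS S -> Y) -> measurable_fun setT f.
Proof. by move=> mf; exact: measurableT_comp mf (measurable_sig_id hW (S := S)). Qed.

(** At the first split the expected weight shrinks by the factor 1 - c, and exp (- c u) solves K' =
    (1 - c) K - K. *)
Lemma touches_bound n x a A u : 0 <= u -> a \notin A -> external a x ->
  (P [set w | touches n (W w) x a A u] <= (weight eps (size A) * expR (- c * u))%:E)%E.
Proof.
have c1 : c < 1 by case/andP: c01.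
elim: n x A u => [|n IH] x A u u0 aA ax.
  have -> : [set w | touches 0 (W w) x a A u] = set0 by apply/seteqP; split.
  by rewrite measure0 lee_fin mulr_ge0 ?weight_ge0 ?expR_ge0.
have [A0|A0] := pselect (A = [::]).
  have -> : [set w | touches n.+1 (W w) x a A u] = set0.
    by apply/seteqP; split => // w [].
  by rewrite measure0 lee_fin mulr_ge0 ?weight_ge0 ?expR_ge0.
have sA : (0 < size A)%N by case: (A) A0.
have wA := weight_ge1 eps0 sA.
have wA0 : 0 < weight eps (size A) by exact: lt_le_trans wA.
pose S1 := at_vertex x; pose S2 := offspring_sources x.
pose E := [set z : TS S1 * TS S2 | touch_step (W z.1) x a A u
  (fun b A' v => touches n (W z.2) (child x b) a A' v)].
have m1 : measurable_noise_at ((fun z => W z.1) : TS S1 * TS S2 -> noise R) x.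
  exact: (@measurable_noise_comp R _ _ (TS S1) (TS S1 * TS S2)%type fst W x
    measurable_fst (noise_at_sig M W (@subset_refl _ _))).
have mE : measurable E.
  apply: (@measurable_touch_step R _ (TS S1 * TS S2)%type (fun z => W z.1) (fun=> u) x a A
    (fun z b A' v => touches n (W z.2) (child x b) a A' v)) => // b A'.
  apply: (@measurable_touches R _ (TS S1 * TS S2)%type n (fun z => W z.2)
    (fun z => u - lifetime (W z.1) x)).
    move=> y by_; exact: (@noise_below_offspring _ (TS S1 * TS S2)%type x snd
      measurable_snd b y by_).
  exact: (@measurable_age R _ (TS S1 * TS S2)%type (fun=> u) (fun z => W z.1) x m1).
(* Dividing by the current weight normalises the renewal to [K 0 = 1]. Before the split, the
   probability 1 is then absorbed by a weight of at least 1, as [A] is nonempty. *)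
pose Y w := weight eps (size (inherited (W w) x a A)) / weight eps (size A).
pose g w : \bar R := (if (u < lifetime (W w) x)%R then 1
  else (0 + Y w * expR (- c * (u - lifetime (W w) x)))%:E)%E.
have Y0 w : 0 <= Y w by rewrite divr_ge0// weight_ge0.
have sec (w : T) : (P [set w' : T | E (w, w')] <= (weight eps (size A))%:E * g w)%E.
  have mEw : measurable [set w' : T | E (w, w')].
    have mp : measurable_fun setT ((fun w' => (w, w')) : TS S2 -> TS S1 * TS S2).
      exact: measurable_pair1.
    have := measurableT_comp mp (measurable_sig_id hW (S := S2)).
    by move=> /(_ measurableT _ mE); rewrite setTI.
  rewrite /g; case: ifPn => [_|].
    by rewrite mule1; apply: le_trans (probability_le1 _ mEw) _; rewrite lee_fin.
  rewrite -leNgt => lu; rewrite add0r -EFinM mulrA /Y mulrCA divff ?gt_eqF// mulr1.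
  have u'0 : 0 <= u - lifetime (W w) x by rewrite subr_ge0.
  apply: le_trans (IH (child x (mchoice (W w) a x)) _ _ u'0
    (inherited_notin (W w) ax aA) (external_child _ ax)).
  apply: le_measure; rewrite ?inE//.
    apply: (@measurable_touches R _ T n W (fun=> u - lifetime (W w) x)) => // y _.
    exact: noise_at hW y.
  by move=> w' [_ [|[]]]//=; rewrite ltNge lu.
have -> : [set w | touches n.+1 (W w) x a A u] = [set w : T | E (w, w)] by [].
have := @freeze_prob R lambda d T P M W hW S1 S2 unit [:: tt] (fun=> E)
  (fun w => (weight eps (size A))%:E * g w)%E.
rewrite big_seq1; move=> /(_ (below_sources_children x) (fun=> mE)) fr.
have g0 w : (0 <= g w)%E.
  by rewrite /g; case: ifP => // _; rewrite lee_fin addr_ge0// mulr_ge0// expR_ge0.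
have mY : measurable_fun setT (Y : TS (discrete_at x) -> R).
  by apply: measurable_funM => //; exact: measurable_weight_inherited.
have EY : (\int[P]_w (Y w)%:E <= (1 - c)%:E)%E.
  rewrite (eq_integral (fun w => (weight eps (size A))^-1%:E *
    (weight eps (size (inherited (W w) x a A)))%:E)%E); last first.
    by move=> w _; rewrite -EFinM mulrC.
  have mwi : measurable_fun setT
      (fun w => (weight eps (size (inherited (W w) x a A)))%:E : \bar R).
    apply/measurable_EFinP; exact: measurable_from_sig (@measurable_weight_inherited x a A).
  rewrite ge0_integralZl; [|exact: measurableT|exact: mwi|
    by move=> w _; rewrite lee_fin weight_ge0|by rewrite lee_fin invr_ge0 ltW].
  have r0 : (0 <= (weight eps (size A))^-1%:E)%E by rewrite lee_fin invr_ge0 ltW.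
  have h := expectation_weight_inherited hlambda hW eps0 contraction x aA A0.
  apply: le_trans (lee_wpmul2l r0 h) _.
  by rewrite -EFinM lee_fin mulrCA mulVf ?mulr1// gt_eqF.
have bd := @renewal_bound R lambda d T P M W hW x u (1 - c) Y (fun=> 0)
  (fun s => expR (- c * s)) (fun s => expR (- c * s)) u0 mY Y0 EY.
apply: le_trans (fr _) _; first by move=> w; rewrite big_seq1.
have mg : measurable_fun setT g.
  apply: measurable_fun_ifT => //.
    by apply: measurable_fun_ltr => //; exact: measurable_lifetime (noise_at hW x).
  apply/measurable_EFinP; apply: measurable_funD => //; apply: measurable_funM.
    exact: measurable_from_sig mY.
  apply: measurableT_comp; first exact: measurable_expR.
  by apply: measurable_funM => //; apply: measurable_funB => //; exact: measurable_lifetime (noise_at hW x).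
rewrite ge0_integralZl//; last by rewrite lee_fin ltW.
rewrite EFinM lee_wpmul2l//; first by rewrite lee_fin ltW.
apply: bd => //.
- by move=> s; exact: cvg_cst.
- exact: continuous_expRM.
- by rewrite mulr0 expR0.
move=> s; rewrite (_ : _ - _ = - c * expR (- c * s)); first exact: is_derive_expRM.
ring.
Qed.

Lemma touches_mono n W0 x a A (u : R) : touches n W0 x a A u -> touches n.+1 W0 x a A u.
Proof.
elim: n x A u => [//|n IH] x A u [A0 h]; split=> //.
by case: h => [|[lu h]]; [left|right; split=> //; exact: IH].
Qed.

Lemma touches_ex_bound x a A u : 0 <= u -> a \notin A -> external a x ->
  (P [set w | exists n, touches n (W w) x a A u] <=
   (weight eps (size A) * expR (- c * u))%:E)%E.
Proof.
move=> u0 aA ax.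
pose E n := [set w | touches n (W w) x a A u].
have mE n : measurable (E n).
  by apply: (@measurable_touches R _ T n W (fun=> u)) => // y _; exact: noise_at hW y.
have -> : [set w | exists n, touches n (W w) x a A u] = \bigcup_n E n.
  by apply/seteqP; split => w [n]; exists n.
have nd : nondecreasing_seq E.
  by apply/nondecreasing_seqP => n; apply/subsetPset => w; exact: touches_mono.
have cv := @nondecreasing_cvg_mu _ _ _ P E mE (bigcupT_measurable E mE) nd.
rewrite -(cvg_lim _ cv)//; apply: lime_le; first by apply/cvg_ex; eexists; exact: cv.
by apply: nearW => n; exact: touches_bound.
Qed.

End Bounds.

(** * Expected size of the cluster inside a block *)

Fixpoint words (n : nat) : seq (seq bool) :=
  if n is n'.+1 then
    [::] :: [seq true :: r | r <- words n'] ++ [seq false :: r | r <- words n']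
  else [::].

Section ReachBound.
Context (R : realType) (lambda : R) (hlambda : 0 < lambda).
Context d (T : measurableType d) (P : probability T R).
Variables (M : T -> ngraph_space) (W : T -> noise R).
Hypothesis hW : cluster_noise P M W lambda.
Local Notation TS S := (g_sigma_algebraType (sig M W S)).
Local Notation q := (expR (- (lambda / 2))).
Variables eps c : R.
Hypothesis eps0 : 0 < eps.
Hypothesis c01 : 0 < c < 1.
Hypothesis contraction : forall k, (0 < k)%N ->
  1 + eps * (k%:R / 2 + lambda / 2) - q * 2^-1 ^+ k <= (1 - c) * weight eps k.

Lemma noise_below_sig x y : below x y ->
  measurable_noise_at (W : TS (below_sources x) -> noise R) y.
Proof. by move=> xy; apply: noise_at_sig => s ys; exists y. Qed.

Lemma sig_reaches r x a u :
  <<s sig M W (below_sources x) >> [set w | reaches r (W w) x a u].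
Proof.
apply: (@measurable_reaches R _ (TS (below_sources x)) r W (fun=> u)) => // y.
exact: noise_below_sig.
Qed.

Lemma sig_touches x a A u :
  <<s sig M W (below_sources x) >> [set w | exists n, touches n (W w) x a A u].
Proof.
apply: (@measurable_exists _ (TS (below_sources x))) => n.
apply: (@measurable_touches R _ (TS (below_sources x)) n W (fun=> u)) => // y.
exact: noise_below_sig.
Qed.

(** The split of [x] is frozen in [W0]. Reaching the exit edge and continuing beyond it take place
    in opposite halves, hence the product; a union bound runs over the exit edges. *)
Lemma reach_step_prob (W0 : noise R) b r x a u : external a x ->
  lifetime W0 x <= u ->
  (P [set w | reach_step W0 b x a u
      (fun a' v => reaches r (W w) (child x b) a' v)
      (fun a' A' v => exists n, touches n (W w) (child x (~~ b)) a' A' v)] <=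
   (if mchoice W0 a x == b then
      P [set w | reaches r (W w) (child x b) a (u - lifetime W0 x)] else 0) +
   \sum_(i < new_edges W0 x)
     P [set w | reaches r (W w) (child x b) (fresh x i) (u - lifetime W0 x)] *
     (weight eps (new_edges W0 x) * expR (- c * (u - lifetime W0 x)))%:E)%E.
Proof.
move=> ax lu; set v := u - lifetime W0 x; set N := new_edges W0 x.
have v0 : 0 <= v by rewrite subr_ge0.
pose targets i := a :: rem (fresh x i) (fresh_edges x N).
pose Z a' := [set w | reaches r (W w) (child x b) a' v].
pose Q i := [set w | exists n, touches n (W w) (child x (~~ b)) (fresh x i) (targets i) v].
have mZ a' : measurable (Z a') := sigma_sig_measurable hW (@sig_reaches r (child x b) a' v).
have mQ i : measurable (Q i) :=
  sigma_sig_measurable hW (@sig_touches (child x (~~ b)) (fresh x i) (targets i) v).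
pose A0 := if mchoice W0 a x == b then Z a else set0.
have mA0 : measurable A0 by rewrite /A0; case: ifP.
have mB : measurable (\big[setU/set0]_(i < N) (Z (fresh x i) `&` Q i)).
  by apply: bigsetU_measurable => i _; exact: measurableI.
set X := [set w | _].
have XE : X = A0 `|` \big[setU/set0]_(i < N) (Z (fresh x i) `&` Q i).
  rewrite -(bigcup_mkord _ (fun i => Z (fresh x i) `&` Q i)).
  apply/seteqP; split => w.
    move=> [_ [[ab Za]|[i iN [Zi Qi]]]]; first by left; rewrite /A0 ab eqxx.
    by right; exists i.
  rewrite /A0; move=> h; split=> //; case: h => [|[i iN [Zi Qi]]].
    by case: ifPn => // /eqP ab Za; left.
  by right; exists i.
rewrite XE; apply: le_trans (measureU2 P mA0 mB) _; apply: leeD.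
  by rewrite /A0; case: ifP => // _; rewrite measure0.
apply: le_trans (@Boole_inequality _ _ _ P (fun i => Z (fresh x i) `&` Q i) N _) _.
  by move=> i _; exact: measurableI.
apply: lee_sum => i _.
have e : P (Z (fresh x i) `&` Q i) = (P (Z (fresh x i)) * P (Q i))%E.
  exact: (sig_indep hW (below_sources_siblings x b)
    (@sig_reaches r (child x b) (fresh x i) v)
    (@sig_touches (child x (~~ b)) (fresh x i) (targets i) v)).
apply: (@le_trans _ _ (P (Z (fresh x i)) * P (Q i))%E); first by rewrite -e.
apply: lee_wpmul2l => //.
have uF : uniq (fresh_edges x N) by rewrite map_inj_uniq ?iota_uniq// => k l [].
have iF : fresh x i \in fresh_edges x N by apply/fresh_edgesP; exists i.
(* The followed edge is traded for [a], so the number of targets is again [N]. *)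
have sz : size (targets i) = N.
  rewrite /= size_rem// size_map size_iota prednK//.
  exact: (leq_ltn_trans (leq0n i) (ltn_ord i)).
have fe : external (fresh x i) (child x (~~ b)) by exact: fresh_external.
have fn : fresh x i \notin targets i.
  rewrite in_cons negb_or; apply/andP; split.
    by apply/eqP => h; apply: (external_fresh (i := i) ax); rewrite h.
  by rewrite mem_rem_uniq// inE eqxx.
have := touches_ex_bound hlambda hW eps0 c01 contraction v0 fn fe.
by rewrite sz.
Qed.

Let m := lambda / 2.
(** Twice E[N + eps N^2] for N Poisson of mean [m]: an upper bound for the mean of [cross_weight]
    below. *)
Let y := 2 * (m + eps * (m * (m + 1))).
(* The solution of [K' = y * exp (- c * s) * K] with [K 0 = 1]. *)
Definition reach_limit (u : R) : R := expR (y / c * (1 - expR (- c * u))).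

Lemma reach_limit_derive (s : R) :
  is_derive s 1 reach_limit
    (reach_limit s + y * (expR (- c * s) * reach_limit s) - reach_limit s).
Proof.
have c0 : c != 0 by rewrite gt_eqF//; case/andP: c01.
have d1 : is_derive s 1 (fun s : R => y / c * (1 - expR (- c * s)))
    (y / c * (0 - - c * expR (- c * s))).
  have d0 : is_derive s 1 (fun s => 1 - expR (- c * s)) (0 - - c * expR (- c * s)).
    exact: (is_deriveB (is_derive_cst (1 : R) s 1) (is_derive_expRM (- c) s)).
  exact: (is_deriveZ (y / c) d0).
have d2 := @is_derive1_comp _ expR (fun s => y / c * (1 - expR (- c * s))) s _ _
  (is_derive_expR _) d1.
rewrite (_ : reach_limit s + _ - _ =
  expR (y / c * (1 - expR (- c * s))) * (y / c * (0 - - c * expR (- c * s))))//.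
by rewrite /reach_limit; field.
Qed.

Lemma reach_limit_continuous : continuous reach_limit.
Proof.
move=> s; apply: differentiable_continuous; apply/derivable1_diffP.
exact: (@ex_derive _ _ _ _ _ _ _ (reach_limit_derive s)).
Qed.

Lemma reach_limit_le u : 0 <= u -> reach_limit u <= expR (y / c).
Proof.
have c0 : 0 < c by case/andP: c01.
have y0 : 0 <= y by rewrite /y /m !(mulr_ge0, addr_ge0, divr_ge0)// ltW.
move=> u0; rewrite ler_expR -[leRHS]mulr1; apply: ler_wpM2l.
  by rewrite divr_ge0// ltW.
by rewrite lerBlDr lerDl expR_ge0.
Qed.

(** Two halves to start from, [n] exit edges, and for each a Lyapunov weight of [n] targets, which
    is at most 1 + eps n. *)
Definition cross_weight (n : nat) : R := 2 * (n%:R * (1 + eps * n%:R)).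

Lemma expectation_cross_weight x :
  (\int[P]_w (cross_weight (new_edges (W w) x))%:E <= y%:E)%E.
Proof.
have mn := measurable_new_edges (noise_at hW x).
have mf (f : nat -> R) : measurable_fun setT (fun w => (f (new_edges (W w) x))%:E).
  exact: (measurable_countable_fun (fun n => (f n)%:E) mn).
rewrite (eq_integral (fun w => 2%:E * (new_edges (W w) x)%:R%:E +
    (2 * eps)%:E * ((new_edges (W w) x)%:R ^+ 2)%:E)%E); last first.
  by move=> w _; rewrite -!EFinM -EFinD; congr EFin; rewrite /cross_weight; ring.
have e0 := ltW eps0.
rewrite ge0_integralD; [|exact: measurableT|
  by move=> w _; rewrite mule_ge0// lee_fin|
  by apply: measurable_funeM; exact: (mf (fun n => n%:R))|
  by move=> w _; rewrite mule_ge0// lee_fin ?mulr_ge0 ?sqr_ge0|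
  by apply: measurable_funeM; exact: (mf (fun n => n%:R ^+ 2))].
rewrite ge0_integralZl; [|exact: measurableT|exact: (mf (fun n => n%:R))|
  by move=> w _; rewrite lee_fin|by rewrite lee_fin].
rewrite ge0_integralZl; [|exact: measurableT|exact: (mf (fun n => n%:R ^+ 2))|
  by move=> w _; rewrite lee_fin sqr_ge0|by rewrite lee_fin mulr_ge0].
have -> : y = 2 * m + 2 * eps * (m * (m + 1)) by rewrite /y; ring.
rewrite (EFinD (2 * m)) (EFinM 2 m) (EFinM (2 * eps)); apply: leeD.
  by apply: lee_wpmul2l; [rewrite lee_fin|exact: (expectation_new_edges hlambda hW x)].
apply: lee_wpmul2l; first by rewrite lee_fin mulr_ge0.
exact: (expectation_new_edges_sqr hlambda hW x).
Qed.

(** Induction on depth, with one bound for all external markers. After a split at remaining age v,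
    the half carrying [a] contributes K(v), and every exit edge contributes K(v) times the decay of
    the connection probability in the other half. The resulting renewal equation is the one solved
    by [reach_limit]. *)
Lemma reaches_bound n x a u : 0 <= u -> external a x ->
  (\sum_(r <- words n) P [set w | reaches r (W w) x a u] <= (reach_limit u)%:E)%E.
Proof.
elim: n x a u => [|n IH] x a u u0 ax; first by rewrite big_nil lee_fin expR_ge0.
pose S1 := at_vertex x; pose S2 := offspring_sources x.
pose E (r : seq bool) := [set z : TS S1 * TS S2 |
  if r is b :: r' then reach_step (W z.1) b x a u
    (fun a' v => reaches r' (W z.2) (child x b) a' v)
    (fun a' A' v => exists n, touches n (W z.2) (child x (~~ b)) a' A' v)
  else u < lifetime (W z.1) x].
have m1 : measurable_noise_at ((fun z => W z.1) : TS S1 * TS S2 -> noise R) x.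
  exact: (@measurable_noise_comp R _ _ (TS S1) (TS S1 * TS S2)%type fst W x
    measurable_fst (noise_at_sig M W (@subset_refl _ _))).
have m2 b y' : below (child x b) y' ->
    measurable_noise_at ((fun z => W z.2) : TS S1 * TS S2 -> noise R) y'.
  exact: (@noise_below_offspring _ _ _ M W _ (TS S1 * TS S2)%type x snd measurable_snd).
have mage : measurable_fun setT (fun z : TS S1 * TS S2 => u - lifetime (W z.1) x).
  exact: (@measurable_age R _ (TS S1 * TS S2)%type (fun=> u) (fun z => W z.1) x m1).
have mE r : measurable (E r).
  case: r => [|b r].
    apply: (@measurable_ltR R _ (TS S1 * TS S2)%type (fun=> u)) => //.
    exact: measurable_lifetime m1.
  apply: (@measurable_reach_step R _ (TS S1 * TS S2)%type (fun z => W z.1) (fun=> u) b x a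
    (fun z a' v => reaches r (W z.2) (child x b) a' v)
    (fun z a' A' v => exists n, touches n (W z.2) (child x (~~ b)) a' A' v)) => // a'.
    apply: (@measurable_reaches R _ (TS S1 * TS S2)%type r (fun z => W z.2)
      (fun z => u - lifetime (W z.1) x)) => //; exact: m2.
  move=> A'; apply: measurable_exists => k.
  apply: (@measurable_touches R _ (TS S1 * TS S2)%type k (fun z => W z.2)
    (fun z => u - lifetime (W z.1) x)) => //; exact: m2.
pose K := reach_limit.
pose Y w := cross_weight (new_edges (W w) x).
pose g w : \bar R := (if (u < lifetime (W w) x)%R then 1
  else (K (u - lifetime (W w) x) + Y w * (expR (- c * (u - lifetime (W w) x)) *
    K (u - lifetime (W w) x)))%:E)%E.
have -> : (\sum_(r <- words n.+1) P [set w | reaches r (W w) x a u] =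
    \sum_(r <- words n.+1) P [set w : T | E r (w, w)])%E by apply: eq_bigr => -[|b r].
apply: le_trans (@freeze_prob R lambda d T P M W hW S1 S2 _ (words n.+1) E g
  (below_sources_children x) mE _) _; last first.
  apply: (@renewal_bound R lambda d T P M W hW x u y Y K
    (fun s => expR (- c * s) * K s) K u0).
  - apply: (@measurable_countable_fun _ (TS (discrete_at x)) _ _ _ _ cross_weight).
    by move=> k; apply: sig_new_edges; split.
  - by move=> w; rewrite /Y /cross_weight !(mulr_ge0, addr_ge0)// ltW.
  - exact: expectation_cross_weight.
  - exact: reach_limit_continuous.
  - move=> s; apply: cvgM; first exact: (continuous_expRM (a := - c)).
    exact: reach_limit_continuous.
  - by move=> s; exact: expR_ge0.
  - by move=> s; rewrite mulr_ge0 ?expR_ge0.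
  - by rewrite /K /reach_limit mulr0 expR0 subrr mulr0 expR0.
  - exact: reach_limit_derive.
(* Before its split [x] is alone in its block, so only the empty word counts. *)
move=> w; rewrite /g; case: ifPn => [ul|].
  rewrite /words -/words big_cons big1_seq ?adde0 ?probability_le1//.
    rewrite (_ : [set w' : T | E [::] (w, w')] = setT) ?probability_setT//.
    by apply/seteqP; split.
  move=> r; rewrite mem_cat => /andP[_ /orP[]/mapP[r' _ ->]];
    rewrite (_ : [set w' : T | _] = set0) ?measure0//;
    by apply/seteqP; split => // w' [/=]; rewrite leNgt ul.
rewrite -leNgt => lu; set v := u - _.
have v0 : 0 <= v by rewrite subr_ge0.
set N := new_edges (W w) x.
rewrite /words -/words big_cons (_ : [set w' : T | E [::] (w, w')] = set0); last first.
  by apply/seteqP; split => // w' /=; rewrite ltNge lu.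
rewrite measure0 add0e big_cat !big_map/=.
(* Both halves pay for the new edges, but exactly one of them receives the term [K v]. *)
have half b : (\sum_(r <- words n) P [set w' : T | E (b :: r) (w, w')] <=
    (if mchoice (W w) a x == b then (K v)%:E else 0) +
    (N%:R * ((1 + eps * N%:R) * (expR (- c * v) * K v)))%:E)%E.
  apply: (@le_trans _ _ (\sum_(r <- words n) ((if mchoice (W w) a x == b then
      P [set w' | reaches r (W w') (child x b) a v] else 0) +
    \sum_(i < N) P [set w' | reaches r (W w') (child x b) (fresh x i) v] *
      (weight eps N * expR (- c * v))%:E))%E).
    by apply: lee_sum => r _; exact: (@reach_step_prob (W w) b r x a u ax lu).
  rewrite big_split /=; apply: leeD.
    case: ifP => _; last by rewrite big1.
    by apply: IH => //; exact: external_child.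
  rewrite exchange_big /=.
  apply: (@le_trans _ _ (\sum_(i < N) ((1 + eps * N%:R) * (expR (- c * v) * K v))%:E)%E).
    apply: lee_sum => i _; rewrite -ge0_sume_distrl; last by move=> r _.
    rewrite (_ : (1 + eps * N%:R) * _ = K v * ((1 + eps * N%:R) * expR (- c * v))); last by ring.
    rewrite (EFinM (K v)); apply: lee_pmul => //.
    - exact: sume_ge0.
    - by rewrite lee_fin mulr_ge0 ?weight_ge0 ?expR_ge0.
    - by apply: IH => //; exact: fresh_external.
    - by rewrite lee_fin ler_wpM2r ?expR_ge0// weight_le.
  by rewrite sumEFin lee_fin sumr_const card_ord -[leLHS]mulr_natl.
apply: le_trans (leeD (half true) (half false)) _.
rewrite /Y /cross_weight -/N; case: (mchoice _ a x) => /=;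
  rewrite ?add0e ?addr0 -!EFinD lee_fin; lra.
Qed.

End ReachBound.

(** * Measurability of the cluster process *)

Section Reachable.
Variables (V E : Type) (G : Defs.rgraph V E).

Fixpoint reachable_in (n : nat) (u v : V) : Prop :=
  if n is n'.+1 then exists z, reachable_in n' u z /\ linked G z v else u = v.

Lemma reachableP u v : reachable G u v <-> exists n, reachable_in n u v.
Proof.
split=> [uv|[n]].
  have uv' := clos_rt_rtn1 _ _ _ _ uv; elim: v / uv' {uv}.
    by exists 0%N.
  by move=> v1 v2 h _ [n hn]; exists n.+1, v1.
elim: n v => [v /= ->|n IH v [z [/IH uz zv]]]; first exact: rt_refl.
by apply: rt_trans uz _; exact: rt_step.
Qed.

End Reachable.

Section MeasurableCluster.
Context (R : realType) d (T : measurableType d).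
Variables (M : T -> ngraph_space) (W : T -> noise R) (t : R).
Hypothesis mM : measurable_fun setT M.
Hypothesis mW : forall x, measurable_noise_at W x.

Lemma cylinder_measurable (A : set ngraph) : ngraph_cylinders A ->
  measurable [set w | A (M w)].
Proof.
move=> cA; have sA : (measurable : set (set ngraph_space)) A by exact: sub_sigma_algebra.
by have := mM measurableT sA; rewrite setTI.
Qed.

Lemma measurable_vset v : measurable [set w | vset (M w) v].
Proof. by apply: (@cylinder_measurable [set G | vset G v]); constructor 1; exists v. Qed.

Lemma measurable_eset e : measurable [set w | eset (M w) e].
Proof. by apply: (@cylinder_measurable [set G | eset G e]); constructor 2; exists e. Qed.

Lemma measurable_ends e v : measurable [set w | ends (M w) e v].
Proof. by apply: (@cylinder_measurable [set G | ends G e v]); constructor 3; exists e, v. Qed.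

Lemma measurable_groot v : measurable [set w | groot (M w) = v].
Proof. by apply: (@cylinder_measurable [set G | groot G = v]); constructor 4; exists v. Qed.

Lemma measurable_split_time x : measurable_fun setT (fun w => split_time (W w) x).
Proof. by apply: measurable_sum => k; exact: measurable_lifetime (mW _). Qed.

Lemma measurable_implyb (b : bool) (Q : T -> Prop) : measurable [set w | Q w] ->
  measurable [set w | b -> Q w].
Proof.
case: b => mQ.
  rewrite (_ : [set w | _] = [set w | Q w])//.
  by apply/seteqP; split => w /= h; [exact: h|].
by rewrite (_ : [set w | _] = setT)//; apply/seteqP; split.
Qed.

Lemma measurable_alive x : measurable [set w | alive (W w) t x].
Proof.
have h1 : measurable [set w | forall k, (k < size x.2)%N ->
    split_time (W w) (ancestor x k) <= t].
  apply: (@measurable_forall _ T nat (fun k w => (k < size x.2)%N ->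
    split_time (W w) (ancestor x k) <= t)) => k.
  apply: measurable_implyb.
  exact: (measurable_leR (measurable_split_time _)).
have h2 : measurable [set w | t < split_time (W w) x].
  exact: (measurable_ltR _ (measurable_split_time _)).
exact: measurable_set_and h1 h2.
Qed.

Lemma measurable_has_split x : measurable [set w | has_split (W w) t x].
Proof.
apply: (@measurable_forall _ T nat (fun k w => (k <= size x.2)%N ->
  split_time (W w) (ancestor x k) <= t)) => k; apply: measurable_implyb.
exact: (measurable_leR (measurable_split_time _)).
Qed.

Lemma measurable_position a x y :
  measurable [set w | position (W w) t (mchoice (W w) a) x y].
Proof.
rewrite /position /=; apply: measurable_set_and; first exact: measurable_alive.
apply: measurable_exists => n.
elim: n y => [|n IH] y; first exact: (@measurable_const _ T (y = x)).
apply: (@measurable_dep _ T vertex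
  (fun w => iter n (fun z => child z (mchoice (W w) a z)) x)
  (fun z w => y = child z (mchoice (W w) a z))) => z.
  by rewrite (_ : [set w | _] = [set w | z = iter n (fun z => child z (mchoice (W w) a z)) x])//;
    apply/seteqP; split => w /=.
apply: (@measurable_dep _ T bool (fun w => mchoice (W w) a z)
  (fun b _ => y = child z b)) => b; first exact: measurable_mchoice (mW z) _ _.
exact: measurable_const.
Qed.

Local Notation full w := (full_process (W w) (M w) t).

Lemma measurable_full_eset e : measurable [set w | eset (full w) e].
Proof.
case: e => [e|[x k]] /=; first exact: measurable_eset.
rewrite (_ : [set w | _] = [set w | vset (M w) x.1 /\ (has_split (W w) t x /\
  (k < new_edges (W w) x)%N)]); last first.
  by apply/seteqP; split => w /= [] // ? [].
apply: measurable_set_and; first exact: measurable_vset.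
apply: measurable_set_and; first exact: measurable_has_split.
apply: (@measurable_dep _ T nat (fun w => new_edges (W w) x) (fun n _ => (k < n)%N)) => n.
  exact: measurable_new_edges (mW x) n.
exact: measurable_const.
Qed.

Lemma measurable_full_ends e y : measurable [set w | ends (full w) e y].
Proof.
case: e => [e|[x k]] /=.
  rewrite (_ : [set w | _] = [set w | exists v, ends (M w) e v /\
    position (W w) t (mchoice (W w) (Some (inl e))) (initial v) y]); last first.
    by apply/seteqP; split => w /= [v]; [exists v|move=> []; exists v].
  apply: measurable_exists => v; apply: measurable_set_and; first exact: measurable_ends.
  exact: measurable_position.
rewrite (_ : [set w | _] = [set w | exists b,
    position (W w) t (mchoice (W w) (Some (inr (x, k)))) (child x b) y]); last first.
  by apply/seteqP; split => w /= [b]; exists b.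
by apply: measurable_exists => b; exact: measurable_position.
Qed.

(** [xget] picks an arbitrary element, but the position is unique, so the root is [y] exactly when
    [y] is the position, or there is none and [y] is the default. *)
Lemma measurable_full_groot y : measurable [set w | groot (full w) = y].
Proof.
pose pos w := position (W w) t (mchoice (W w) None) (initial (groot (M w))).
have mpos z : measurable [set w | pos w z].
  apply: (@measurable_dep _ T nat (fun w => groot (M w))
    (fun v w => position (W w) t (mchoice (W w) None) (initial v) z)) => v.
    exact: measurable_groot.
  exact: measurable_position.
rewrite (_ : [set w | _] = [set w | pos w y \/
    ((forall z, ~ pos w z) /\ initial (groot (M w)) = y)]).
  apply: measurable_set_or => //; apply: measurable_set_and.
    by apply: measurable_forall => z; exact: measurable_set_not.
  apply: (@measurable_dep _ T nat (fun w => groot (M w)) (fun v _ => initial v = y)) => v.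
    exact: measurable_groot.
  exact: measurable_const.
apply/seteqP; split => w /=.
  by case: xgetP => [z _ pz <-|np <-]; [left|right].
case=> [py|[np <-]].
  case: xgetP => [z _ pz|/(_ y)//]; exact: position_uniq pz py.
by case: xgetP => // z _ /np.
Qed.

Lemma measurable_linked y z : measurable [set w | linked (full w) y z].
Proof.
rewrite (_ : [set w | _] = [set w | exists e, eset (full w) e /\
  (ends (full w) e y /\ ends (full w) e z)]).
  apply: measurable_exists => e; apply: measurable_set_and; first exact: measurable_full_eset.
  by apply: measurable_set_and; exact: measurable_full_ends.
by apply/seteqP; split => w [e]; [exists e|move=> []; exists e].
Qed.

Lemma measurable_reachable y z : measurable [set w | reachable (full w) y z].
Proof.
rewrite (_ : [set w | _] = [set w | exists n, reachable_in (full w) n y z]); last first.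
  by apply/seteqP; split => w /= /reachableP.
apply: measurable_exists => n; elim: n z => [|n IH] z; first exact: measurable_const.
apply: (@measurable_exists _ T vertex) => z'.
by apply: measurable_set_and => //; exact: measurable_linked.
Qed.

Lemma measurable_cluster_vset y :
  measurable [set w | vset (cluster_process (W w) (M w) t) y].
Proof.
apply: measurable_set_and.
  apply: measurable_set_and; first exact: measurable_vset.
  exact: measurable_alive.
apply: (@measurable_dep _ T vertex (fun w => groot (full w))
  (fun z w => reachable (full w) z y)) => z; first exact: measurable_full_groot.
exact: measurable_reachable.
Qed.

End MeasurableCluster.

(** * Cardinality as a sum of tail indicators *)

Section AtLeast.
Variable I : countType.
Implicit Types S : set I.

(** Finite witnesses make this event a countable union, also when [S] is infinite. *)
Definition atleast (k : nat) S : Prop :=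
  exists s : seq I, [/\ uniq s, size s = k & forall i, i \in s -> S i].

(** The sum is min(|S|, n); a single list realises it. *)
Lemma atleast_sum (S : set I) n : exists s : seq I,
  [/\ uniq s, forall i, i \in s -> S i &
      (\sum_(k < n) nat_of_bool `[< atleast k.+1 S >] <= size s)%N].
Proof.
elim: n => [|n [s [us sS IH]]]; first by exists [::]; rewrite big_ord0; split.
have [|h] := asboolP (atleast n.+1 S); last first.
  by exists s; split=> //; rewrite big_ord_recr /=; case: asboolP => //; rewrite addn0.
move=> [s' [us' ss' sS']]; exists s'; split=> //; rewrite ss'.
apply: (@leq_trans (\sum_(k < n.+1) 1)%N); last by rewrite sum1_card card_ord.
by apply: leq_sum => k _; case: `[< _ >].
Qed.

Lemma atleast_le k k' S : (k <= k')%N -> atleast k' S -> atleast k S.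
Proof.
move=> kk' [s [us ss sS]]; exists (take k s); split; first exact: take_uniq.
  by rewrite size_takel// ss.
by move=> i /mem_take; exact: sS.
Qed.

Lemma counting_le_atleast (R : realType) S :
  (counting S <= \sum_(k <oo) (nat_of_bool `[< atleast k.+1 S >])%:R%:E :> \bar R)%E.
Proof.
have key n : atleast n S ->
    (n%:R%:E <= \sum_(k <oo) (nat_of_bool `[< atleast k.+1 S >])%:R%:E :> \bar R)%E.
  move=> aS; apply: (@le_trans _ _ (\sum_(0 <= k < n)
      (nat_of_bool `[< atleast k.+1 S >])%:R%:E)%E); last first.
    by apply: nneseries_lim_ge => k _; rewrite lee_fin.
  rewrite big_mkord (eq_bigr (fun=> 1%E)).
    by rewrite sumEFin sumr_const card_ord.
  move=> k _; rewrite (asboolT (_ : atleast k.+1 S))//.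
  by apply: atleast_le aS; exact: ltn_ord.
rewrite /counting; case: ifPn => [/asboolP fS|/asboolP iS].
  apply: key; exists (finmap.enum_fset (fset_set S)); split=> //; first exact: finmap.fset_uniq.
  by move=> i; rewrite in_fset_set// => /set_mem.
rewrite leye_eq; apply/eqP/eqyP => r r0.
have aS : atleast (Num.bound r) S.
  have [C CS cC] := infinite_set_fset (Num.bound r) iS.
  exists (take (Num.bound r) (finmap.enum_fset C)); split; first exact/take_uniq/finmap.fset_uniq.
    by rewrite size_takel.
  by move=> i /mem_take iC; apply: CS.
apply: le_trans (key (Num.bound r) aS).
by rewrite lee_fin ltW// archi_boundP// ltW.
Qed.

Lemma counting_ge_size (R : realType) S (s : seq I) : uniq s ->
  (forall i, i \in s -> S i) -> ((size s)%:R%:E <= counting S :> \bar R)%E.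
Proof.
move=> us sS; rewrite /counting; case: ifPn => [/asboolP fS|_]; last exact: leey.
rewrite lee_fin ler_nat; apply: uniq_leq_size => // i /sS Si.
by rewrite in_fset_set//; exact: mem_set.
Qed.

Lemma sum_asbool S (s : seq I) :
  (\sum_(i <- s) nat_of_bool `[< S i >])%N = size [seq i <- s | `[< S i >]].
Proof.
by rewrite size_filter; elim: s => [|i s IH]; rewrite ?big_nil ?big_cons//= IH.
Qed.

Lemma size_le_sum S (s s0 : seq I) : uniq s -> {subset s <= s0} ->
  (forall i, i \in s -> S i) -> (size s <= \sum_(i <- s0) nat_of_bool `[< S i >])%N.
Proof.
move=> us ss0 sS; rewrite sum_asbool; apply: uniq_leq_size => // i si.
by rewrite mem_filter ss0// andbT; apply/asboolP; exact: sS.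
Qed.

Lemma sum_le_counting (R : realType) S (s : seq I) : uniq s ->
  (\sum_(i <- s) (nat_of_bool `[< S i >])%:R%:E <= counting S :> \bar R)%E.
Proof.
move=> us; rewrite sumEFin -natr_sum sum_asbool; apply: counting_ge_size.
  exact: filter_uniq.
by move=> i; rewrite mem_filter => /andP[/asboolP].
Qed.

End AtLeast.

(** * Finiteness of the expected size *)

Lemma words_mem r n : (size r < n)%N -> r \in words n.
Proof.
elim: n r => [//|n IH] [|b r] //= rn; rewrite in_cons mem_cat; apply/orP; right.
by case: b; apply/orP; [left|right]; apply/map_f/IH.
Qed.

Lemma words_sumS (R : realType) (g : seq bool -> \bar R) n :
  (\sum_(r <- words n.+1) g r = g [::] + (\sum_(r <- words n) g (true :: r) +
    \sum_(r <- words n) g (false :: r)))%E.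
Proof. by rewrite big_cons big_cat !big_map. Qed.

Lemma words_sum_mono (R : realType) (g : seq bool -> \bar R) n :
  (forall r, 0 <= g r)%E -> (\sum_(r <- words n) g r <= \sum_(r <- words n.+1) g r)%E.
Proof.
elim: n g => [|n IH] g g0; first by rewrite big_nil; exact: sume_ge0.
rewrite words_sumS [leRHS]words_sumS; apply: leeD2l; apply: leeD.
  by apply: (IH (fun r => g (true :: r))).
by apply: (IH (fun r => g (false :: r))).
Qed.

(** Invariance speaks only of measurable isomorphism-invariant events. These tails are such events,
    and the expected size is recovered by summing them. *)
Definition many_vertices (k : nat) : set ngraph := [set G | atleast k (vset G)].

Lemma many_vertices_invariant k : iso_invariant (many_vertices k).
Proof.
move=> G H [f [g [fb _ _ _]]] [s [us ss sG]].
have [fG finj _] := fb.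
exists [seq f i | i <- s]; split; last 2 first.
- by rewrite size_map.
- by move=> j /mapP[i /sG Gi ->]; exact: fG.
rewrite map_inj_in_uniq// => i j /sG Gi /sG Gj; apply: finj; exact: mem_set.
Qed.

Lemma measurable_atleast d (T : measurableType d) (I : countType) (V : T -> set I) k :
  (forall i, measurable [set w | V w i]) -> measurable [set w | atleast k (V w)].
Proof.
move=> mV; apply: measurable_exists => s.
rewrite (_ : [set w | _] = [set w | (uniq s /\ size s = k) /\ (forall i, i \in s -> V w i)]).
  apply: measurable_set_and; first exact: measurable_const.
  by apply: measurable_forall => i; exact: measurable_implyb.
by apply/seteqP; split => w; [case|case=> -[]].
Qed.

Lemma many_vertices_measurable k : measurable (many_vertices k : set ngraph_space).
Proof.
apply: (@measurable_atleast _ ngraph_space nat (fun G : ngraph => vset G)) => i.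
by apply: sub_sigma_algebra; constructor 1; exists i.
Qed.

Section Finiteness.
Context (R : realType) (lambda : R) (hlambda : 0 < lambda).
Context d (T : measurableType d) (P : probability T R).
Variables (M : {RV P >-> ngraph_space}) (W : T -> noise R).
Hypothesis hdeg : (\int[P]_w root_degree (M w) < +oo)%E.
Hypothesis hW : cluster_noise P M W lambda.
Hypothesis hinv : cluster_invariant P M W.
Local Notation TS S := (g_sigma_algebraType (sig M W S)).
Local Notation q := (expR (- (lambda / 2))).
Variables eps c : R.
Hypothesis eps0 : 0 < eps.
Hypothesis c01 : 0 < c < 1.
Hypothesis contraction : forall k, (0 < k)%N ->
  1 + eps * (k%:R / 2 + lambda / 2) - q * 2^-1 ^+ k <= (1 - c) * weight eps k.

Let S1 : set source := [set InitialGraph].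
Let S2 : set source := ~` S1.
Local Notation TT := (TS S1 * TS S2)%type.
Let m := lambda / 2.
Let limit : R := expR (2 * (m + eps * (m * (m + 1))) / c).

Lemma initial_sources_disjoint : S1 `&` S2 = set0.
Proof. exact: setICr. Qed.

Lemma measurable_initial : measurable_fun setT ((fun z => M z.1) : TT -> ngraph_space).
Proof.
have mM : measurable_fun setT ((fun w => M w) : TS S1 -> ngraph_space).
  move=> _ B mB; apply: sub_sigma_algebra; exists InitialGraph => //.
  by exists B.
exact: measurableT_comp mM measurable_fst.
Qed.

Lemma measurable_noise2 x : measurable_noise_at ((fun z => W z.2) : TT -> noise R) x.
Proof.
have xS : at_vertex x `<=` S2 by move=> s xs s1; move: xs; rewrite s1.
exact: (@measurable_noise_comp R _ _ (TS S2) TT snd W x measurable_snd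
  (noise_at_sig M W xS)).
Qed.

Definition root_reaches (t : R) (r : seq bool) : set T :=
  [set w | reaches r (W w) (initial (groot (M w))) None t].

(* Off these events the cluster of the root is made of descendants of the
   initial root. *)
Definition root_touches (t : R) (e : nat) : set T :=
  [set w | (eset (M w) e /\ ends (M w) e (groot (M w))) /\
    exists n, touches n (W w) (initial (groot (M w))) None [:: Some (inl e)] t].

Lemma root_reaches_bound n t : 0 <= t ->
  (\sum_(r <- words n) P (root_reaches t r) <= limit%:E)%E.
Proof.
move=> t0.
pose E r := [set z : TT | reaches r (W z.2) (initial (groot (M z.1))) None t].
have mE r : measurable (E r).
  apply: (@measurable_dep _ TT nat (fun z => groot (M z.1))
    (fun v z => reaches r (W z.2) (initial v) None t)) => v.
    exact: (measurable_groot measurable_initial).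
  by apply: (@measurable_reaches R _ TT r (fun z => W z.2) (fun=> t)) => // x _;
    exact: measurable_noise2.
have := @freeze_prob R lambda d T P M W hW S1 S2 _ (words n) E (fun=> limit%:E)
  initial_sources_disjoint mE.
rewrite integral_cst//= probability_setT mule1; apply => w.
have := @reaches_bound R lambda hlambda d T P M W hW eps c eps0 c01 contraction n
  (initial (groot (M w))) None t t0 I.
move=> /le_trans; apply; rewrite lee_fin.
exact: (reach_limit_le hlambda eps0 c01 t0).
Qed.

(** Given the initial graph, each edge at the root is a list of one target, hence [weight eps 1].
    The edges at the root with label below [n] number at most the degree. *)
Lemma root_touches_bound n t : 0 <= t ->
  (\sum_(e <- iota 0 n) P (root_touches t e) <=
   (weight eps 1 * expR (- c * t))%:E * \int[P]_w root_degree (M w))%E.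
Proof.
move=> t0; set delta := weight eps 1 * expR (- c * t).
have delta0 : 0 <= delta by rewrite mulr_ge0 ?weight_ge0 ?expR_ge0.
pose inc (G : ngraph) e := eset G e /\ ends G e (groot G).
have minc d' (Y : measurableType d') (f : Y -> ngraph_space) : measurable_fun setT f ->
    forall e, measurable [set w | inc (f w) e].
  move=> mf e; apply: measurable_set_and; first exact: measurable_eset.
  apply: (@measurable_dep _ Y nat (fun w => groot (f w)) (fun v w => ends (f w) e v)) => v.
    exact: measurable_groot.
  exact: measurable_ends.
pose E e := [set z : TT | inc (M z.1) e /\
  exists n, touches n (W z.2) (initial (groot (M z.1))) None [:: Some (inl e)] t].
have mE e : measurable (E e).
  apply: measurable_set_and; first exact: (minc _ TT (fun z => M z.1) measurable_initial).
  apply: (@measurable_dep _ TT nat (fun z => groot (M z.1))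
    (fun v z => exists n, touches n (W z.2) (initial v) None [:: Some (inl e)] t)) => v.
    exact: (measurable_groot measurable_initial).
  apply: measurable_exists => k.
  by apply: (@measurable_touches R _ TT k (fun z => W z.2) (fun=> t)) => // x _;
    exact: measurable_noise2.
pose g w : \bar R := (\sum_(e <- iota 0 n) (nat_of_bool `[< inc (M w) e >])%:R%:E)%E.
have mg : measurable_fun setT g.
  apply: emeasurable_sum => e; apply/measurable_EFinP.
  apply: (@measurable_countable_fun _ T _ R bool (fun w => `[< inc (M w) e >])
    (fun b => (nat_of_bool b)%:R)) => b.
  have mi := minc _ T M (measurable_funPT M) e.
  case: b; [rewrite (_ : [set w | _] = [set w | inc (M w) e])//|
    rewrite (_ : [set w | _] = [set w | ~ inc (M w) e])].
  - by apply/seteqP; split => w /= => /asboolP.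
  - exact: measurable_set_not.
  - by apply/seteqP; split => w /=; [move=> /asboolPn|move=> h; apply/asboolPn].
have g0 w : (0 <= g w)%E by apply: sume_ge0 => e _; rewrite lee_fin.
have gd w : (g w <= root_degree (M w))%E.
  by apply: (@sum_le_counting _ R [set e | inc (M w) e]); exact: iota_uniq.
apply: (@le_trans _ _ (\int[P]_w (delta%:E * g w))%E); last first.
  rewrite ge0_integralZl//.
  by apply: lee_wpmul2l; [rewrite lee_fin|exact: le_integral_ge0].
apply: (@freeze_prob R lambda d T P M W hW S1 S2 _ (iota 0 n) E _
  initial_sources_disjoint mE) => w.
rewrite /g ge0_sume_distrr; last by move=> e _; rewrite lee_fin.
apply: lee_sum => e _; case: asboolP => /= ince; last first.
  rewrite mule0 (_ : [set w' : T | E e (w, w')] = set0) ?measure0//.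
  by apply/seteqP; split => // w' [].
rewrite mule1 (_ : [set w' : T | E e (w, w')] = [set w' | exists n,
  touches n (W w') (initial (groot (M w))) None [:: Some (inl e)] t]); last first.
  by apply/seteqP; split => w' => [[]|h].
exact: (@touches_ex_bound R lambda hlambda d T P M W hW eps c eps0 c01 contraction
  (initial (groot (M w))) None [:: Some (inl e)] t t0).
Qed.

Lemma measurable_root_reaches t r : measurable (root_reaches t r).
Proof.
apply: (@measurable_dep _ T nat (fun w => groot (M w))
  (fun v w => reaches r (W w) (initial v) None t)) => v.
  exact: (measurable_groot (measurable_funPT M)).
by apply: (@measurable_reaches R _ T r W (fun=> t)) => // x _; exact: noise_at hW x.
Qed.

Lemma measurable_root_touches t e : measurable (root_touches t e).
Proof.
apply: measurable_set_and.
  apply: measurable_set_and; first exact: (measurable_eset (measurable_funPT M)).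
  apply: (@measurable_dep _ T nat (fun w => groot (M w)) (fun v w => ends (M w) e v)) => v.
    exact: (measurable_groot (measurable_funPT M)).
  exact: (measurable_ends (measurable_funPT M)).
apply: (@measurable_dep _ T nat (fun w => groot (M w))
  (fun v w => exists n, touches n (W w) (initial v) None [:: Some (inl e)] t)) => v.
  exact: (measurable_groot (measurable_funPT M)).
apply: measurable_exists => k.
by apply: (@measurable_touches R _ T k W (fun=> t)) => // x _; exact: noise_at hW x.
Qed.

Definition reach_count (t : R) (n : nat) (w : T) : \bar R :=
  (\sum_(r <- words n) (nat_of_bool `[< root_reaches t r w >])%:R%:E)%E.

Lemma reach_count_nd t w : nondecreasing_seq (reach_count t ^~ w).
Proof.
by apply/nondecreasing_seqP => n; apply: words_sum_mono => r; rewrite lee_fin.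
Qed.

Lemma asbool_indic (A : set T) w : (nat_of_bool `[< A w >])%:R = \1_A w :> R.
Proof. by rewrite indicE; congr ((nat_of_bool _)%:R); apply/asboolP/idP; rewrite inE. Qed.

Lemma reach_count_lim t : 0 <= t ->
  (\int[P]_w limn (reach_count t ^~ w) <= limit%:E)%E.
Proof.
move=> t0.
have mi r : measurable_fun setT
    (fun w => (nat_of_bool `[< root_reaches t r w >])%:R%:E : \bar R).
  under eq_fun do rewrite asbool_indic.
  by apply/measurable_EFinP/measurable_indic; exact: measurable_root_reaches.
have mc n : measurable_fun setT (reach_count t n).
  by apply: emeasurable_sum => r; exact: mi.
have c0 n w : setT w -> (0 <= reach_count t n w)%E.
  by move=> _; apply: sume_ge0 => r _; rewrite lee_fin.
rewrite monotone_convergence//; last by move=> w _; exact: reach_count_nd.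
apply: lime_le.
  apply: ereal_nondecreasing_is_cvgn => i j ij; apply: ge0_le_integral => //.
  - by move=> w; exact: c0.
  - by move=> w _; exact: reach_count_nd.
apply: nearW => n; rewrite /reach_count ge0_integral_sum//.
apply: le_trans (root_reaches_bound n t0); apply: lee_sum => r _.
under eq_integral do rewrite asbool_indic.
by rewrite integral_indic ?setIT//; exact: measurable_root_reaches.
Qed.

(** A pathwise bound on min(|cluster|, n): the trivial bound [n] if some initial edge touches, and
    otherwise the number of words reached in the block of the initial root. *)
Lemma truncated_size_le n t w :
  (\sum_(k < n) (nat_of_bool `[< many_vertices k.+1 (cluster_at M W t w) >])%:R%:E <=
   n%:R%:E * (\1_(\bigcup_e root_touches t e) w)%:E +
   limn (reach_count t ^~ w) :> \bar R)%E.
Proof.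
have lim0 k : (reach_count t k w <= limn (reach_count t ^~ w))%E.
  apply: lime_ge; first exact: ereal_nondecreasing_is_cvgn (reach_count_nd t w).
  by exists k => // j /= kj; exact: reach_count_nd.
have lim00 : (0 <= limn (reach_count t ^~ w))%E.
  by apply: le_trans (lim0 0%N); rewrite /reach_count big_nil.
have [s [us sV]] := atleast_sum (vset (cluster_at M W t w)) n.
rewrite -(ler_nat R) natr_sum -lee_fin -sumEFin => sn.
have [bad|nbad] := pselect ((\bigcup_e root_touches t e) w).
  rewrite indicE mem_set// mule1; apply: (@le_trans _ _ n%:R%:E); last exact: leeDl.
  rewrite sumEFin lee_fin -natr_sum ler_nat.
  apply: (@leq_trans (\sum_(k < n) 1)%N); last by rewrite sum1_card card_ord.
  by apply: leq_sum => k _; case: `[< _ >].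
rewrite indicE memNset// mule0 add0e.
apply: le_trans sn _.
(* Reads the word back from a label; labels of cluster vertices always decode, so the default is
   never met. *)
pose h (i : nat) : seq bool := if @choice.unpickle vertex i is Some y then y.2 else [::].
have sh i : i \in s -> i = @choice.pickle vertex (groot (M w), h i) /\ root_reaches t (h i) w.
  move=> /sV[y Vy <-]; rewrite /h choice.pickleK.
  have [[r -> rr]|[e [k [Ee oe tk]]]] := cluster_cover Vy; first by [].
  by case: nbad; exists e => //; split=> //; exists k.
(* The successor is due to [words k] containing the words of length strictly less than [k]. *)
pose k := (\max_(i <- s) size (h i)).+1.
apply: le_trans (lim0 k); rewrite /reach_count sumEFin lee_fin -natr_sum ler_nat.
rewrite -(size_map h s).
apply: (@size_le_sum _ (fun r => root_reaches t r w)).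
- rewrite map_inj_in_uniq// => i j /sh[iE _] /sh[jE _] hij.
  by rewrite iE jE hij.
- move=> r /mapP[i si ->]; apply: words_mem; rewrite ltnS.
  by apply: leq_bigmax_seq.
- by move=> r /mapP[i /sh[_ ri] ->].
Qed.

Lemma measurable_cluster_many k t :
  measurable [set w | many_vertices k (cluster_at M W t w)].
Proof.
apply: (@measurable_atleast _ T nat (fun w => vset (cluster_at M W t w))) => i.
rewrite (_ : [set w | _] = [set w | exists y : vertex,
    vset (cluster_process (W w) (M w) t) y /\ choice.pickle y = i]).
  apply: measurable_exists => y; apply: measurable_set_and; last exact: measurable_const.
  exact: (@measurable_cluster_vset R d T M W t (measurable_funPT M)
    (fun x => noise_at hW x) y).
by apply/seteqP; split => w [y]; [exists y|move=> []; exists y].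
Qed.

(** By invariance the tails of [M] are those of the cluster at time [t]. The left side is thus free
    of [t], which can be sent far away. *)
Lemma many_vertices_sum n t : 0 <= t ->
  (\sum_(k < n) P [set w | many_vertices k.+1 (M w)] <=
   (n%:R * (weight eps 1 * expR (- c * t)))%:E * \int[P]_w root_degree (M w) +
   limit%:E)%E.
Proof.
move=> t0.
have PE k : P [set w | many_vertices k (M w)] =
    P [set w | many_vertices k (cluster_at M W t w)].
  apply/esym; apply: (hinv t0); first exact: many_vertices_measurable.
  exact: many_vertices_invariant.
have mB : measurable (\bigcup_e root_touches t e).
  by apply: bigcupT_measurable => e; exact: measurable_root_touches.
have PB : (P (\bigcup_e root_touches t e) <=
    (weight eps 1 * expR (- c * t))%:E * \int[P]_w root_degree (M w))%E.
  apply: le_trans (generalized_Boole_inequality P (measurable_root_touches t) mB) _.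
  apply: nneseries_le => // j; rewrite /index_iota subn0; exact: root_touches_bound.
have mr j : measurable_fun setT (reach_count t j).
  apply: emeasurable_sum => r; under eq_fun do rewrite asbool_indic.
  by apply/measurable_EFinP/measurable_indic; exact: measurable_root_reaches.
have mlim : measurable_fun setT (fun w => limn (reach_count t ^~ w)).
  apply: (emeasurable_fun_cvg (reach_count t)) => // w _.
  exact: ereal_nondecreasing_is_cvgn (reach_count_nd t w).
have l0 w : (0 <= limn (reach_count t ^~ w))%E.
  apply: lime_ge; first exact: ereal_nondecreasing_is_cvgn (reach_count_nd t w).
  by apply: nearW => j; apply: sume_ge0 => r _; rewrite lee_fin.
apply: (@le_trans _ _ (\int[P]_w (n%:R%:E * (\1_(\bigcup_e root_touches t e) w)%:E +
    limn (reach_count t ^~ w)))%E).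
  have mi k : measurable_fun setT
      (fun w => (nat_of_bool `[< many_vertices k.+1 (cluster_at M W t w) >])%:R%:E : \bar R).
    apply/measurable_EFinP.
    rewrite (_ : (fun w => _) = \1_[set w | many_vertices k.+1 (cluster_at M W t w)]).
      exact/measurable_indic/measurable_cluster_many.
    by apply/funext => w; rewrite -asbool_indic.
  have E1 k : P [set w | many_vertices k.+1 (M w)] =
      (\int[P]_w (nat_of_bool `[< many_vertices k.+1 (cluster_at M W t w) >])%:R%:E)%E.
    have mC := measurable_cluster_many k.+1 t.
    transitivity (\int[P]_w (\1_[set w | many_vertices k.+1 (cluster_at M W t w)] w)%:E)%E.
      by rewrite integral_indic// setIT PE.
    by apply: eq_integral => w _; rewrite -asbool_indic.
  rewrite (eq_bigr _ (fun (k : 'I_n) _ => E1 k)) -ge0_integral_sum//.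
  apply: le_integral_ge0 => w; last exact: truncated_size_le.
  by apply: sume_ge0 => k _; rewrite lee_fin.
have m1 : measurable_fun setT (fun w => (\1_(\bigcup_e root_touches t e) w)%:E : \bar R).
  by apply/measurable_EFinP/measurable_indic.
rewrite ge0_integralD; [|exact: measurableT|by move=> w _; rewrite mule_ge0 ?lee_fin|
  exact: measurable_funeM|by []|exact: mlim].
rewrite ge0_integralZl; [|exact: measurableT|exact: m1|by move=> w _; rewrite lee_fin|
  by rewrite lee_fin].
rewrite integral_indic// setIT EFinM -muleA; apply: leeD.
  by apply: lee_wpmul2l; rewrite ?lee_fin.
exact: reach_count_lim.
Qed.

Lemma size_expectation : (\int[P]_w num_vertices (M w) <= limit%:E + 1)%E.
Proof.
have mi k : measurable [set w | many_vertices k (M w)].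
  apply: (@measurable_atleast _ T nat (fun w => vset (M w))) => i.
  exact: (measurable_vset (measurable_funPT M)).
apply: (@le_trans _ _ (\int[P]_w
    \sum_(k <oo) (\1_[set w | many_vertices k.+1 (M w)] w)%:E))%E.
  apply: le_integral_ge0 => w.
    by rewrite /num_vertices /counting; case: ifP => // _; rewrite lee_fin.
  under eq_eseriesr do rewrite -asbool_indic.
  exact: counting_le_atleast.
rewrite integral_nneseries//; last first.
  by move=> k; exact/measurable_EFinP/measurable_indic.
apply: nneseries_le => [k|n]; first by apply: integral_ge0 => w _; rewrite lee_fin.
rewrite big_mkord; under eq_bigr do rewrite integral_indic// setIT.
have D0 : (0 <= \int[P]_w root_degree (M w))%E.
  apply: integral_ge0 => w _; rewrite /root_degree /counting.
  by case: ifP => // _; rewrite lee_fin.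
(* Finiteness of the expected degree enters here: the decay in time has to beat n times this
   number. *)
have [D DE] : exists D, (\int[P]_w root_degree (M w))%E = D%:E.
  by exists (fine (\int[P]_w root_degree (M w))); rewrite fineK// ge0_fin_numE.
have D0' : 0 <= D by rewrite -lee_fin -DE.
have c0 : 0 < c by case/andP: c01.
(* The time is chosen so that the error term is [x * exp (- x) <= 1]. *)
pose x := n%:R * weight eps 1 * D.
have x0 : 0 <= x by rewrite !mulr_ge0// weight_ge0.
have t0 : 0 <= x / c by rewrite divr_ge0// ltW.
apply: le_trans (many_vertices_sum n t0) _.
rewrite DE addeC -EFinM -!EFinD lee_fin lerD2l.
rewrite (_ : - c * (x / c) = - x); last by field; rewrite gt_eqF.
rewrite (_ : _ * D = x * expR (- x)); last by rewrite /x; ring.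
rewrite expRN ler_pdivrMr ?expR_gt0// mul1r.
by apply: le_trans (expR_ge1Dx x); rewrite lerDr.
Qed.

End Finiteness.

Theorem theorem1p5 (R : realType) (lambda : R) (hlambda : 0 < lambda)
    (d : measure_display) (T : measurableType d) (P : probability T R)
    (M : {RV P >-> ngraph_space}) (W : T -> noise R)
    (hM : forall w, connected_multigraph (M w))
    (hdeg : (\int[P]_w root_degree (M w) < +oo)%E)
    (hW : cluster_noise P M W lambda)
    (hinv : cluster_invariant P M W) :
  (\int[P]_w num_vertices (M w) < +oo)%E.
Proof.
have q01 : 0 < expR (- (lambda / 2)) <= 1.
  by rewrite expR_gt0 -expR0 ler_expR oppr_le0 divr_ge0// ltW.
have [eps [c [eps0 c01 contraction]]] := contraction_exists hlambda q01.
apply: le_lt_trans (size_expectation hlambda hdeg hW hinv eps0 c01 contraction) _.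
by rewrite -EFinD ltry.
Qed.
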